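(* Let $\delta>\delta_{\mathrm{AMP}}:=\frac{64}{\pi^2}-4$ and $\sigma_w^2=0$ (noiseless case). Then for every $\alpha_0\in\mathbb{C}$ with $0<|\alpha_0|\le 1$ and every $\sigma_0^2\in[0,1]$, the state evolution sequences $\{\alpha_t\}_{t\ge1}$, $\{\sigma_t^2\}_{t\ge1}$ satisfy $$\lim_{t\to\infty}|\alpha_t|=1\qquad\text{and}\qquad \lim_{t\to\infty}\sigma_t^2=0.$$
   Context: Complex state evolution (SE). Fix $\delta>0$ and $\sigma_w^2\ge0$. For $\alpha\in\mathbb{C}$ and $\sigma^2\ge0$ with $(\alpha,\sigma^2)\neq(0,0)$, let $\theta_\alpha$ be the argument of $\alpha$ ($\theta_0:=0$) and define $$\psi_1(\alpha,\sigma^2)=e^{\mathrm{i}\theta_\alpha}\int_0^{\pi/2}\frac{|\alpha|\sin^2\theta}{(|\alpha|^2\sin^2\theta+\sigma^2)^{1/2}}\,d\theta,$$ $$\psi_2(\alpha,\sigma^2;\delta,\sigma_w^2)=\frac4\delta\Big(|\alpha|^2+\sigma^2+1-\int_0^{\pi/2}\frac{2|\alpha|^2\sin^2\theta+\sigma^2}{(|\alpha|^2\sin^2\theta+\sigma^2)^{1/2}}\,d\theta\Big)+4\sigma_w^2 .$$ Given $(\alpha_0,\sigma_0^2)\in\mathbb{C}\times\mathbb{R}_{\ge0}\setminus\{(0,0)\}$, the SE sequences are defined by $\alpha_{t+1}=\psi_1(\alpha_t,\sigma_t^2)$, $\sigma_{t+1}^2=\psi_2(\alpha_t,\sigma_t^2;\delta,\sigma_w^2)$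 for $t\ge0$. *)

(* Defs.v *)
From Stdlib Require Import Reals Lra ClassicalEpsilon.
Open Scope R_scope.

(* Riemann integral of f over [a,b] as a value: the (proof-independent)
   value RiemannInt pr for some integrability proof pr; an arbitrary real
   (chosen by epsilon) if f is not Riemann integrable. *)
Definition Rint (f : R -> R) (a b : R) : R :=
  epsilon (inhabits 0)
    (fun v => exists pr : Riemann_integrable f a b, RiemannInt pr = v).

(* Complex numbers represented as pairs (real part, imaginary part). *)
Definition cabs (z : R * R) : R := sqrt (fst z ^ 2 + snd z ^ 2).

(* e^{i theta_z} where theta_z is the argument of z, with theta_0 := 0. *)
Definition cphase (z : R * R) : R * R :=
  if Req_EM_T (cabs z) 0 then (1, 0) else (fst z / cabs z, snd z / cabs z).

Definition psi1 (a : R * R) (s2 : R) : R * R :=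
  let r := cabs a in
  let I := Rint (fun th => r * sin th ^ 2 / sqrt (r ^ 2 * sin th ^ 2 + s2)) 0 (PI / 2) in
  (fst (cphase a) * I, snd (cphase a) * I).

Definition psi2 (a : R * R) (s2 delta sw2 : R) : R :=
  let r := cabs a in
  4 / delta *
    (r ^ 2 + s2 + 1
     - Rint (fun th => (2 * r ^ 2 * sin th ^ 2 + s2) / sqrt (r ^ 2 * sin th ^ 2 + s2)) 0 (PI / 2))
  + 4 * sw2.

(* State evolution: se delta sw2 a0 s0 t = (alpha_t, sigma_t^2). *)
Fixpoint se (delta sw2 : R) (a0 : R * R) (s0 : R) (t : nat) : (R * R) * R :=
  match t with
  | O => (a0, s0)
  | S n => let p := se delta sw2 a0 s0 n in
           (psi1 (fst p) (snd p), psi2 (fst p) (snd p) delta sw2)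
  end.

(* Main.v *)
Require Import Defs.
From Stdlib Require Import Reals Lra Lia Psatz ClassicalEpsilon.
From Coquelicot Require Import Coquelicot.
Open Scope R_scope.

(* With x = sigma^2 / |alpha|^2, A(x) = int sin^2 / sqrt (sin^2 + x) and
   E(x) = int sqrt (sin^2 + x), one step of the state evolution reads
     |alpha'| = A(x),   sigma'^2 = c G(|alpha|, x),   c = 4 / delta,
     G(r, x) = r^2 (1 + x) + 1 - r (A + E)(x),
   so that r = A(x), sigma^2 = x A(x)^2 is the curve where |alpha| is stationary.
   The threshold enters through lam = 2 - 16 / pi^2: delta > delta_AMP means
   c (1 - lam) < 1, and on the curve G <= (1 - lam) sigma^2, that is
   A E - lam x A^2 >= 1. This is an equality at x = 0 and at x = infinity; in between
   the left side first increases and then decreases, because the Riccati equation for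
   E / A makes it cross the root of the quadratic governing the derivative only once.
   G being a convex quadratic in r, sigma^2 is contracted by c (1 - lam) whenever
   |alpha| decreases; hence sigma^2 drops below pi^2 / 16, and then the state lies in a
   rectangle r >= A(X), sigma^2 <= X A(X)^2. When |alpha| increases, the bound
   sigma'^2 >= c min_r G(r, x) from the previous step prevents sigma^2 from overshooting.
   The rectangle is thus mapped into itself, and X shrinks geometrically. *)

(** * The elliptic integrals A and E, bounds on pi, integrability *)

Definition ellA (x : R) : R :=
  RInt (fun t => sin t ^ 2 / sqrt (sin t ^ 2 + x)) 0 (PI / 2).

(** With k^2 = 1 / (1 + x) this is sqrt (1 + x) times the complete elliptic integral of the second
    kind, since sin^2 + x = (1 + x) (1 - k^2 cos^2). *)
Definition ellE (x : R) : R := RInt (fun t => sqrt (sin t ^ 2 + x)) 0 (PI / 2).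

(** The value sin (PI / 6) = 1 / 2 is compared with alternating Taylor sums at 3.14 / 6 (degree 5)
    and 3.142 / 6 (degree 7), sin being increasing there. *)
Lemma PI_bounds : 3.14 < PI < 3.142.
Proof.
  (* Turns factorials into integer numerals that [lra] can handle. *)
  assert (F : forall n z, Z.of_nat (Factorial.fact n) = z -> INR (Factorial.fact n) = IZR z)
    by (intros n z <-; apply INR_IZR_INZ).
  assert (F3 := F 3%nat 6%Z eq_refl). assert (F5 := F 5%nat 120%Z eq_refl).
  assert (F7 := F 7%nat 5040%Z ltac:(vm_compute; reflexivity)).
  assert (F1 := F 1%nat 1%Z eq_refl).
  pose proof PI_4 as H4; pose proof PI2_3_2 as H5; pose proof sin_PI6 as H6.
  assert (sin (3.14 / 6) < 1 / 2) as L.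
  { destruct (pre_sin_bound (3.14 / 6) 0) as [_ H]; try lra.
    apply Rle_lt_trans with (1 := H).
    unfold sin_approx, sin_term; cbn [sum_f_R0 Nat.mul Nat.add].
    rewrite F1, F3, F5; lra. }
  assert (1 / 2 < sin (3.142 / 6)) as U.
  { destruct (pre_sin_bound (3.142 / 6) 1) as [H _]; try lra.
    apply Rlt_le_trans with (2 := H).
    unfold sin_approx, sin_term; cbn [sum_f_R0 Nat.mul Nat.add].
    rewrite F1, F3, F5, F7; lra. }
  split; apply Rnot_le_lt; intros Hle.
  - assert (sin (PI / 6) <= sin (3.14 / 6)); [|lra].
    apply sin_incr_1; lra.
  - assert (sin (3.142 / 6) <= sin (PI / 6)); [|lra].
    apply sin_incr_1; lra.
Qed.

Lemma sin_quarter_bounds t : 0 < t < PI / 2 -> 0 < sin t < 1.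
Proof.
  intros [H1 H2]; pose proof PI_bounds.
  split; [apply sin_gt_0; lra|].
  rewrite <- sin_PI2; apply sin_increasing_1; lra.
Qed.

Lemma is_RInt_sin_quarter : is_RInt sin 0 (PI / 2) 1.
Proof.
  replace 1 with (minus (- cos (PI / 2)) (- cos 0))
    by (rewrite cos_PI2, cos_0; unfold minus, plus, opp; simpl; ring).
  apply (is_RInt_derive (fun t => - cos t) sin).
  - intros x _; auto_derive; [easy|ring].
  - intros x _; apply (ex_derive_continuous sin); auto_derive; easy.
Qed.

Lemma is_RInt_sin2_quarter : is_RInt (fun t => sin t ^ 2) 0 (PI / 2) (PI / 4).
Proof.
  replace (PI / 4) with (minus ((PI / 2 - sin (PI / 2) * cos (PI / 2)) / 2)
                               ((0 - sin 0 * cos 0) / 2))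
    by (rewrite cos_PI2, sin_0; unfold minus, plus, opp; simpl; field).
  apply (is_RInt_derive (fun t => (t - sin t * cos t) / 2) (fun t => sin t ^ 2)).
  - intros x _; auto_derive; [easy|].
    pose proof (sin2_cos2 x) as H; unfold Rsqr in H; simpl; nra.
  - intros x _; apply (ex_derive_continuous (fun t => sin t ^ 2)); auto_derive; easy.
Qed.

Lemma sin2_plus_pos x t : 0 < x -> 0 < sin t ^ 2 + x.
Proof. intros H; pose proof (pow2_ge_0 (sin t)); lra. Qed.

Lemma is_RInt_ellA x : 0 <= x ->
  is_RInt (fun t => sin t ^ 2 / sqrt (sin t ^ 2 + x)) 0 (PI / 2) (ellA x).
Proof.
  intros [Hx | <-]; apply (RInt_correct (V := R_CompleteNormedModule)).
  - apply (ex_RInt_continuous (V := R_CompleteNormedModule)); intros t _.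
    apply (ex_derive_continuous (fun t => sin t ^ 2 / sqrt (sin t ^ 2 + x))).
    pose proof (sin2_plus_pos x t Hx) as H.
    auto_derive; repeat split; try easy.
    apply Rgt_not_eq, sqrt_lt_R0; exact H.
  (* At x = 0 the integrand agrees with sin t on the open interval, which determines the
     integral. *)
  - eexists; eapply is_RInt_ext; [|exact is_RInt_sin_quarter].
    pose proof PI_bounds.
    intros t; rewrite Rmin_left, Rmax_right by lra; intros Ht.
    destruct (sin_quarter_bounds t Ht).
    change (sin t = sin t ^ 2 / sqrt (sin t ^ 2 + 0)).
    rewrite Rplus_0_r, sqrt_pow2 by lra; field; lra.
Qed.

Lemma is_RInt_ellE x : 0 <= x ->
  is_RInt (fun t => sqrt (sin t ^ 2 + x)) 0 (PI / 2) (ellE x).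
Proof.
  intros Hx; apply (RInt_correct (V := R_CompleteNormedModule)).
  apply (ex_RInt_continuous (V := R_CompleteNormedModule)); intros t _.
  apply (continuous_comp (fun t => sin t ^ 2 + x) sqrt).
  - apply (ex_derive_continuous (fun t => sin t ^ 2 + x)); auto_derive; easy.
  - apply continuous_sqrt.
Qed.

(** With u = sqrt (sin^2 t + x), the derivative of sin t cos t / u is x (1 + x) / u^3 - u, and sin t
    cos t / u vanishes at both ends. *)
Lemma is_RInt_sqrt_inv3 x : 0 < x ->
  is_RInt (fun t => / sqrt (sin t ^ 2 + x) ^ 3) 0 (PI / 2) (ellE x / (x * (1 + x))).
Proof.
  intros Hx.
  assert (is_RInt (fun t => x * (1 + x) / sqrt (sin t ^ 2 + x) ^ 3 - sqrt (sin t ^ 2 + x))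
            0 (PI / 2) 0) as H.
  { replace 0 with (minus (sin (PI / 2) * cos (PI / 2) / sqrt (sin (PI / 2) ^ 2 + x))
                          (sin 0 * cos 0 / sqrt (sin 0 ^ 2 + x))) at 2
      by (rewrite cos_PI2, sin_0; unfold minus, plus, opp, Rdiv; simpl; ring).
    apply (is_RInt_derive (fun t => sin t * cos t / sqrt (sin t ^ 2 + x))
      (fun t => x * (1 + x) / sqrt (sin t ^ 2 + x) ^ 3 - sqrt (sin t ^ 2 + x)));
      intros t _; pose proof (sin2_plus_pos x t Hx) as Hp;
      pose proof (sqrt_lt_R0 _ Hp) as Hs.
    - auto_derive; [repeat split; try easy; apply Rgt_not_eq; exact Hs|].
      pose proof (sqrt_sqrt _ (Rlt_le _ _ Hp)) as Hq.
      pose proof (sin2_cos2 t) as Hsc; unfold Rsqr in Hsc.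
      replace (sin t * (sin t * 1) + x) with (sin t ^ 2 + x) by ring.
      set (u := sqrt (sin t ^ 2 + x)) in *.
      replace x with (u * u - sin t ^ 2) by lra.
      assert (Hc : cos t * cos t = 1 - sin t * sin t) by lra.
      field_simplify_eq; [|lra].
      replace (cos t ^ 2) with (1 - sin t ^ 2) by (simpl; lra).
      ring.
    - apply (ex_derive_continuous
        (fun t => x * (1 + x) / sqrt (sin t ^ 2 + x) ^ 3 - sqrt (sin t ^ 2 + x))).
      auto_derive; repeat split; try easy.
      replace (sin t * (sin t * 1) + x) with (sin t ^ 2 + x) by ring.
      assert (0 < sqrt (sin t ^ 2 + x) ^ 3) by (apply pow_lt; lra).
      apply Rgt_not_eq.
      simpl in *; lra. }
  pose proof (is_RInt_scal _ _ _ (/ (x * (1 + x))) _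
    (is_RInt_plus _ _ _ _ _ _ H (is_RInt_ellE x (Rlt_le _ _ Hx)))) as H2.
  replace (ellE x / (x * (1 + x))) with (scal (/ (x * (1 + x))) (plus 0 (ellE x)))
    by (unfold scal, plus; simpl; unfold mult; simpl; field; lra).
  eapply is_RInt_ext; [|exact H2].
  intros t _; simpl; unfold scal, plus; simpl; unfold mult; simpl.
  pose proof (sqrt_lt_R0 _ (sin2_plus_pos x t Hx)) as Hs; simpl in Hs.
  field; lra.
Qed.

(** * Linear inequalities between the integrals, reduced to pointwise ones *)

(* Here s = sin t, u = sqrt (s^2 + x) and v = sqrt (s^2 + y). *)
Lemma quarter_integral_nonneg x y a1 b1 a2 b2 j m k z : 0 <= x -> 0 < y ->
  (forall s u v, 0 < s < 1 -> 0 < u -> 0 < v -> u * u = s * s + x -> v * v = s * s + y ->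
     0 <= a1 * (s ^ 2 / u) + b1 * u + a2 * (s ^ 2 / v) + b2 * v
          + j * / v ^ 3 + m * s + k * s ^ 2 + z) ->
  0 <= a1 * ellA x + b1 * ellE x + a2 * ellA y + b2 * ellE y
       + j * (ellE y / (y * (1 + y))) + m * 1 + k * (PI / 4) + z * (PI / 2).
Proof.
  intros Hx Hy H; pose proof PI_bounds.
  assert (Hc : is_RInt (fun _ => z) 0 (PI / 2) (z * (PI / 2))).
  { replace (z * (PI / 2)) with (scal (PI / 2 - 0) z)
      by (unfold scal; simpl; unfold mult; simpl; ring).
    apply (is_RInt_const (V := R_NormedModule)). }
  refine (is_RInt_ge_0 _ 0 (PI / 2) _ _ (is_RInt_plus _ _ _ _ _ _ (is_RInt_plus _ _ _ _ _ _
    (is_RInt_plus _ _ _ _ _ _ (is_RInt_plus _ _ _ _ _ _ (is_RInt_plus _ _ _ _ _ _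
    (is_RInt_plus _ _ _ _ _ _ (is_RInt_plus _ _ _ _ _ _
      (is_RInt_scal _ _ _ a1 _ (is_RInt_ellA x Hx))
      (is_RInt_scal _ _ _ b1 _ (is_RInt_ellE x Hx)))
      (is_RInt_scal _ _ _ a2 _ (is_RInt_ellA y (Rlt_le _ _ Hy))))
      (is_RInt_scal _ _ _ b2 _ (is_RInt_ellE y (Rlt_le _ _ Hy))))
      (is_RInt_scal _ _ _ j _ (is_RInt_sqrt_inv3 y Hy)))
      (is_RInt_scal _ _ _ m _ is_RInt_sin_quarter))
      (is_RInt_scal _ _ _ k _ is_RInt_sin2_quarter)) Hc) _); [lra|].
  intros t Ht; destruct (sin_quarter_bounds t Ht) as [Hs1 Hs2].
  assert (0 < sin t ^ 2) by (apply pow_lt; lra).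
  refine (H (sin t) (sqrt (sin t ^ 2 + x)) (sqrt (sin t ^ 2 + y)) (conj Hs1 Hs2) _ _ _ _);
    try (apply sqrt_lt_R0; lra); rewrite sqrt_sqrt; simpl in *; lra.
Qed.
(** Here w stands for s^2 / u and is given only through w u = s^2, so that the pointwise claims
    become polynomial. *)
Lemma quarter_integral_nonneg1 x a b m k z : 0 <= x ->
  (forall s u w, 0 < s < 1 -> 0 < u -> u * u = s * s + x -> w * u = s * s -> 0 < w ->
     0 <= a * w + b * u + m * s + k * (s * s) + z) ->
  0 <= a * ellA x + b * ellE x + m + k * (PI / 4) + z * (PI / 2).
Proof.
  intros Hx H.
  pose proof (quarter_integral_nonneg x 1 a b 0 0 0 m k z Hx Rlt_0_1) as G.
  enough (0 <= a * ellA x + b * ellE x + 0 * ellA 1 + 0 * ellE 1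
          + 0 * (ellE 1 / (1 * (1 + 1))) + m * 1 + k * (PI / 4) + z * (PI / 2)) by lra.
  apply G; intros s u v Hs Hu Hv Hus Hvs.
  assert (0 < s * s) by nra.
  specialize (H s u (s ^ 2 / u) Hs Hu Hus).
  assert (0 < s ^ 2 / u) by (apply Rdiv_lt_0_compat; simpl; lra).
  assert (s ^ 2 / u * u = s * s) by (field; lra).
  simpl in *; lra.
Qed.

(** * Elementary bounds on A, E and A + E *)

Lemma ellA_lower x : 0 <= x -> PI / 4 <= sqrt (1 + x) * ellA x.
Proof.
  intros Hx.
  enough (0 <= sqrt (1 + x) * ellA x + 0 * ellE x + 0 + (-1) * (PI / 4) + 0 * (PI / 2)) by lra.
  apply quarter_integral_nonneg1; [easy|]; intros s u w Hs Hu Hus Hwu Hw.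
  assert (u <= sqrt (1 + x)) by (apply Rsqr_incr_0; unfold Rsqr; [rewrite sqrt_sqrt; nra|lra|apply sqrt_pos]).
  nra.
Qed.

Lemma ellA_pos x : 0 <= x -> 0 < ellA x.
Proof.
  intros Hx; pose proof (ellA_lower x Hx); pose proof PI_bounds.
  assert (0 < sqrt (1 + x)) by (apply sqrt_lt_R0; lra).
  nra.
Qed.

(** Pointwise sqrt x <= u. With [ellA_lower], x A(x)^2 stays below pi^2 / 16 and tends to it as x
    grows. *)
Lemma ellA_upper x : 0 <= x -> sqrt x * ellA x <= PI / 4.
Proof.
  intros Hx.
  enough (0 <= (- sqrt x) * ellA x + 0 * ellE x + 0 + 1 * (PI / 4) + 0 * (PI / 2)) by lra.
  apply quarter_integral_nonneg1; [easy|]; intros s u w Hs Hu Hus Hwu Hw.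
  assert (sqrt x <= u) by (apply Rsqr_incr_0; unfold Rsqr; [rewrite sqrt_sqrt; nra|apply sqrt_pos|lra]).
  nra.
Qed.

Lemma ellA_le_1 x : 0 <= x -> ellA x <= 1.
Proof.
  intros Hx.
  enough (0 <= (-1) * ellA x + 0 * ellE x + 1 + 0 * (PI / 4) + 0 * (PI / 2)) by lra.
  apply quarter_integral_nonneg1; [easy|]; intros s u w Hs Hu Hus Hwu Hw.
  assert (s <= u) by nra.
  nra.
Qed.

Lemma ellA_near_0 x : 0 <= x -> 1 - PI / 2 * sqrt x <= ellA x.
Proof.
  intros Hx.
  enough (0 <= 1 * ellA x + 0 * ellE x + (-1) + 0 * (PI / 4) + sqrt x * (PI / 2)) by lra.
  apply quarter_integral_nonneg1; [easy|]; intros s u w Hs Hu Hus Hwu Hw.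
  pose proof (sqrt_pos x) as Hp; pose proof (sqrt_sqrt x Hx) as Hq.
  assert (u <= s + sqrt x) by nra.
  assert (s <= u) by nra.
  assert (s * (u - s) <= sqrt x * u) by nra.
  nra.
Qed.

(** The difference is the integral of x cos^2 t / u. *)
Lemma ellE_ge_ellA x : 0 <= x -> (1 + x) * ellA x <= ellE x.
Proof.
  intros Hx.
  enough (0 <= (- (1 + x)) * ellA x + 1 * ellE x + 0 + 0 * (PI / 4) + 0 * (PI / 2)) by lra.
  apply quarter_integral_nonneg1; [easy|]; intros s u w Hs Hu Hus Hwu Hw.
  enough ((1 + x) * w <= u) by lra.
  apply Rmult_le_reg_r with u; [easy|].
  replace ((1 + x) * w * u) with ((1 + x) * (w * u)) by ring; rewrite Hwu, Hus.
  assert (0 <= x * (1 - s * s)) by (apply Rmult_le_pos; nra); lra.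
Qed.

Lemma ellE_ge_sqrt x : 0 <= x -> PI / 2 * sqrt x <= ellE x.
Proof.
  intros Hx.
  enough (0 <= 0 * ellA x + 1 * ellE x + 0 + 0 * (PI / 4) + (- sqrt x) * (PI / 2)) by lra.
  apply quarter_integral_nonneg1; [easy|]; intros s u w Hs Hu Hus Hwu Hw.
  pose proof (sqrt_pos x) as Hp; pose proof (sqrt_sqrt x Hx) as Hq.
  nra.
Qed.

Lemma ellE_le_near_0 x : 0 <= x -> ellE x <= 1 + PI / 2 * sqrt x.
Proof.
  intros Hx.
  enough (0 <= 0 * ellA x + (-1) * ellE x + 1 + 0 * (PI / 4) + sqrt x * (PI / 2)) by lra.
  apply quarter_integral_nonneg1; [easy|]; intros s u w Hs Hu Hus Hwu Hw.
  pose proof (sqrt_pos x) as Hp; pose proof (sqrt_sqrt x Hx) as Hq.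
  nra.
Qed.

(* Chord of the concave function a |-> sqrt (x + c a) on [0, 1], with a = s^2. *)
Lemma sqrt_chord p q s u : 0 <= p -> p <= q -> 0 < s < 1 -> 0 < u ->
  u * u = p * p + (q * q - p * p) * (s * s) -> p + (q - p) * (s * s) <= u.
Proof.
  intros Hp Hq Hs Hu H.
  apply Rsqr_incr_0; unfold Rsqr; [|nra|lra].
  rewrite H.
  assert (0 < s * s < 1) by nra.
  assert (0 <= s * s * (1 - s * s)) by (apply Rmult_le_pos; lra).
  assert (0 <= (q - p) * (q - p) * (s * s * (1 - s * s)))
    by (apply Rmult_le_pos; [apply Rle_0_sqr|easy]).
  lra.
Qed.

Lemma ellE_chord x : 0 <= x -> PI / 4 * (sqrt x + sqrt (1 + x)) <= ellE x.
Proof.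
  intros Hx.
  enough (0 <= 0 * ellA x + 1 * ellE x + 0 + (- (sqrt (1 + x) - sqrt x)) * (PI / 4)
               + (- sqrt x) * (PI / 2)) by lra.
  apply quarter_integral_nonneg1; [easy|]; intros s u w Hs Hu Hus Hwu Hw.
  pose proof (sqrt_chord (sqrt x) (sqrt (1 + x)) s u (sqrt_pos x)) as H.
  rewrite !sqrt_sqrt in H by lra.
  enough (sqrt x + (sqrt (1 + x) - sqrt x) * (s * s) <= u) by lra.
  apply H; try lra; try nra.
  apply sqrt_le_1; lra.
Qed.

(** Dropping w^2 from (w + u)^2 leaves at least x + 3 s^2, whose square root lies above its
    chord. *)
Lemma ellB_chord x : 0 <= x -> PI / 4 * (sqrt x + sqrt (x + 3)) <= ellA x + ellE x.
Proof.
  intros Hx.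
  enough (0 <= 1 * ellA x + 1 * ellE x + 0 + (- (sqrt (x + 3) - sqrt x)) * (PI / 4)
               + (- sqrt x) * (PI / 2)) by lra.
  apply quarter_integral_nonneg1; [easy|]; intros s u w Hs Hu Hus Hwu Hw.
  assert (0 < s * s) by nra.
  set (h := sqrt (x + 3 * (s * s))).
  assert (Hh : 0 < h) by (apply sqrt_lt_R0; lra).
  assert (Hh2 : h * h = x + 3 * (s * s)) by (apply sqrt_sqrt; lra).
  pose proof (sqrt_chord (sqrt x) (sqrt (x + 3)) s h (sqrt_pos x)) as Hch.
  rewrite !sqrt_sqrt in Hch by lra.
  enough (sqrt x + (sqrt (x + 3) - sqrt x) * (s * s) <= h /\ h <= w + u) by lra.
  split.
  - apply Hch; try lra; try nra.
    apply sqrt_le_1; lra.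
  - apply Rsqr_incr_0; unfold Rsqr; [|lra|lra].
    rewrite Hh2.
    replace ((w + u) * (w + u)) with (w * w + 2 * (w * u) + u * u) by ring.
    rewrite Hwu, Hus; nra.
Qed.

(** Jensen for the square root, sin^2 having mean 1 / 2; obtained by integrating 2 m u <= m^2 +
    u^2. *)
Lemma ellE_upper x : 0 <= x -> ellE x <= PI / 2 * sqrt (x + 1 / 2).
Proof.
  intros Hx; set (m := sqrt (x + 1 / 2)).
  assert (Hm : 0 < m) by (apply sqrt_lt_R0; lra).
  assert (Hm2 : m * m = x + 1 / 2) by (apply sqrt_sqrt; lra).
  enough (0 <= 0 * ellA x + (- (2 * m)) * ellE x + 0 + 1 * (PI / 4) + (m * m + x) * (PI / 2)) by nra.
  apply quarter_integral_nonneg1; [easy|]; intros s u w Hs Hu Hus Hwu Hw.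
  pose proof (Rle_0_sqr (m - u)); unfold Rsqr in *; lra.
Qed.

(** Again Jensen, now from (w + u)^2 <= 4 s^2 + x, whose mean is x + 2. *)
Lemma ellB_upper x : 0 <= x -> ellA x + ellE x <= PI / 2 * sqrt (x + 2).
Proof.
  intros Hx; set (m := sqrt (x + 2)).
  assert (Hm : 0 < m) by (apply sqrt_lt_R0; lra).
  assert (Hm2 : m * m = x + 2) by (apply sqrt_sqrt; lra).
  enough (0 <= (- (2 * m)) * ellA x + (- (2 * m)) * ellE x + 0 + 4 * (PI / 4)
               + (m * m + x) * (PI / 2)) by nra.
  apply quarter_integral_nonneg1; [easy|]; intros s u w Hs Hu Hus Hwu Hw.
  assert ((w + u) * (w + u) <= 4 * (s * s) + x);
    [|pose proof (Rle_0_sqr (m - (w + u))); unfold Rsqr in *; lra].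
  replace ((w + u) * (w + u)) with (w * w + 2 * (w * u) + u * u) by ring.
  rewrite Hwu, Hus.
  assert (s * s <= u * u) by nra.
  assert (w <= u) by nra.
  nra.
Qed.

(* Cauchy-Schwarz, as AM-GM with the weight 1 / A. *)
Lemma ellA_ellE_ge_1 x : 0 <= x -> 1 <= ellA x * ellE x.
Proof.
  intros Hx; pose proof (ellA_pos x Hx) as HA.
  enough (0 <= 1 * ellA x + (ellA x * ellA x) * ellE x + (- 2 * ellA x)
               + 0 * (PI / 4) + 0 * (PI / 2)) by nra.
  apply quarter_integral_nonneg1; [easy|]; intros s u w Hs Hu Hus Hwu Hw.
  set (t := ellA x) in *.
  assert (0 <= u * (w + t * t * u - 2 * t * s)); [|nra].
  replace (u * (w + t * t * u - 2 * t * s)) with ((s - t * u) ^ 2) by (simpl; nra).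
  apply pow2_ge_0.
Qed.

Lemma ellA_0 : ellA 0 = 1.
Proof.
  pose proof (ellA_near_0 0 (Rle_refl 0)) as H; rewrite sqrt_0 in H.
  pose proof (ellA_le_1 0 (Rle_refl 0)); lra.
Qed.

Lemma ellE_0 : ellE 0 = 1.
Proof.
  pose proof (ellE_le_near_0 0 (Rle_refl 0)) as H; rewrite sqrt_0 in H.
  pose proof (ellE_ge_ellA 0 (Rle_refl 0)) as H1; rewrite ellA_0 in H1; lra.
Qed.

(** E - (1 + x) A is the integral of x cos^2 t / u, and sqrt x <= u. *)
Lemma cos2_integral_bound x : 0 <= x ->
  sqrt x * (ellE x - (1 + x) * ellA x) <= x * (PI / 4).
Proof.
  intros Hx.
  enough (0 <= (sqrt x * (1 + x)) * ellA x + (- sqrt x) * ellE x + 0 + (- x) * (PI / 4)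
               + x * (PI / 2)) by lra.
  apply quarter_integral_nonneg1; [easy|]; intros s u w Hs Hu Hus Hwu Hw.
  pose proof (sqrt_pos x) as Hp; pose proof (sqrt_sqrt x Hx) as Hq.
  set (t := sqrt x) in *.
  assert (t <= u) by nra.
  assert (0 <= u * (t * (1 + x) * w + - t * u + 0 * s + - x * (s * s) + x)); [|nra].
  replace (u * (t * (1 + x) * w + - t * u + 0 * s + - x * (s * s) + x))
    with (t * (1 + x) * (w * u) - t * (u * u) + x * (1 - s * s) * u) by ring.
  rewrite Hwu, Hus.
  replace (t * (1 + x) * (s * s) - t * (s * s + x) + x * (1 - s * s) * u)
    with (x * (1 - s * s) * (u - t)) by ring.
  apply Rmult_le_pos; [|lra]; apply Rmult_le_pos; nra.
Qed.

(** * Monotonicity and convexity in the parameter *)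

Lemma quarter_integral_nonneg2 x y a1 a2 : 0 <= x -> 0 < y ->
  (forall s u v, 0 < s < 1 -> 0 < u -> 0 < v -> u * u = s * s + x -> v * v = s * s + y ->
     0 <= a1 * v + a2 * u) ->
  0 <= a1 * ellA x + a2 * ellA y.
Proof.
  intros Hx Hy H.
  pose proof (quarter_integral_nonneg x y a1 0 a2 0 0 0 0 0 Hx Hy) as G.
  enough (0 <= a1 * ellA x + 0 * ellE x + a2 * ellA y + 0 * ellE y
          + 0 * (ellE y / (y * (1 + y))) + 0 * 1 + 0 * (PI / 4) + 0 * (PI / 2)) by lra.
  apply G; intros s u v Hs Hu Hv Hus Hvs.
  replace (a1 * (s ^ 2 / u) + 0 * u + a2 * (s ^ 2 / v) + 0 * v + 0 * / v ^ 3
    + 0 * s + 0 * s ^ 2 + 0) with ((a1 * v + a2 * u) * (s ^ 2 / (u * v))) by (field; lra).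
  apply Rmult_le_pos; [exact (H s u v Hs Hu Hv Hus Hvs)|].
  apply Rdiv_le_0_compat; [apply pow2_ge_0|nra].
Qed.

Lemma ellA_decr x y : 0 <= x -> x <= y -> ellA y <= ellA x.
Proof.
  intros Hx [Hxy | <-]; [|lra].
  enough (0 <= 1 * ellA x + (-1) * ellA y) by lra.
  apply quarter_integral_nonneg2; [lra|lra|]; intros s u v Hs Hu Hv Hus Hvs.
  nra.
Qed.

Lemma sqrt_ellA_incr x y : 0 <= x -> x <= y -> sqrt x * ellA x <= sqrt y * ellA y.
Proof.
  intros Hx [Hxy | <-]; [|lra].
  enough (0 <= (- sqrt x) * ellA x + sqrt y * ellA y) by lra.
  apply quarter_integral_nonneg2; [lra|lra|]; intros s u v Hs Hu Hv Hus Hvs.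
  pose proof (sqrt_pos x); pose proof (sqrt_pos y).
  enough (sqrt x * v <= sqrt y * u) by lra.
  apply Rsqr_incr_0; unfold Rsqr; [|nra|nra].
  replace (sqrt x * v * (sqrt x * v)) with (sqrt x * sqrt x * (v * v)) by ring.
  replace (sqrt y * u * (sqrt y * u)) with (sqrt y * sqrt y * (u * u)) by ring.
  rewrite !sqrt_sqrt by lra; rewrite Hus, Hvs; nra.
Qed.

(* As a function of sqrt x, the integrand (2 s^2 + x) / sqrt (s^2 + x) is convex. *)
Lemma ellB_tangent x y : 0 <= x -> 0 < y ->
  ellA y + ellE y + sqrt y * ellE y / (1 + y) * (sqrt x - sqrt y) <= ellA x + ellE x.
Proof.
  intros Hx Hy.
  pose proof (sqrt_pos x) as Hp; pose proof (sqrt_sqrt x Hx) as Hp2.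
  pose proof (sqrt_lt_R0 y Hy) as Hq; pose proof (sqrt_sqrt y (Rlt_le _ _ Hy)) as Hq2.
  (* The derivative of the integrand with respect to sqrt y is y sqrt y / v^3; its integral is the
     slope in the statement, so the tangent bound can be checked pointwise. *)
  pose proof (quarter_integral_nonneg x y 1 1 (-1) (-1)
    (- (y * sqrt y * (sqrt x - sqrt y))) 0 0 0 Hx Hy) as G.
  enough (0 <= 1 * ellA x + 1 * ellE x + (-1) * ellA y + (-1) * ellE y
    + (- (y * sqrt y * (sqrt x - sqrt y))) * (ellE y / (y * (1 + y)))
    + 0 * 1 + 0 * (PI / 4) + 0 * (PI / 2)) as H.
  { replace (sqrt y * ellE y / (1 + y) * (sqrt x - sqrt y)) with
      ((y * sqrt y * (sqrt x - sqrt y)) * (ellE y / (y * (1 + y)))) by (field; lra).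
    lra. }
  apply G; clear G; intros s u v Hs Hu Hv Hus Hvs.
  set (p := sqrt x) in *; set (q := sqrt y) in *.
  (* Cauchy-Schwarz for the vectors (s, p) and (s, q), of norms u and v. *)
  assert (HCS : p * q <= u * v - s * s).
  { enough (p * q + s * s <= u * v) by lra.
    apply Rsqr_incr_0; unfold Rsqr; [|nra|nra].
    replace (u * v * (u * v)) with (u * u * (v * v)) by ring.
    rewrite Hus, Hvs, <- Hp2, <- Hq2.
    pose proof (pow2_ge_0 (s * p - s * q)); nra. }
  assert (Hpq : y * q * (p - q) <= y * (v * (u - v))).
  { replace (v * (u - v)) with (u * v - v * v) by ring.
    rewrite Hvs, <- Hq2; nra. }
  assert (0 <= (v * v) * ((u - v) * (1 - s * s / (u * v))) - y * (u - v)) as K.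
  { replace ((v * v) * ((u - v) * (1 - s * s / (u * v))) - y * (u - v))
      with (s * s * ((u - v) * (u - v) / u) + (v * v - s * s - y) * (u - v)) by (field; lra).
    rewrite Hvs.
    assert (0 <= (u - v) * (u - v) / u)
      by (apply Rdiv_le_0_compat; [pose proof (pow2_ge_0 (u - v)); simpl in *; lra|easy]).
    nra. }
  replace (1 * (s ^ 2 / u) + 1 * u + -1 * (s ^ 2 / v) + -1 * v + - (y * q * (p - q)) * / v ^ 3
    + 0 * s + 0 * s ^ 2 + 0)
    with (/ (v * v) * (((v * v) * ((u - v) * (1 - s * s / (u * v))) - y * (u - v))
          + / v * (y * (v * (u - v)) - y * q * (p - q)))) by (field; lra).
  assert (0 < / v) by (apply Rinv_0_lt_compat; lra).
  apply Rmult_le_pos; [apply Rlt_le, Rinv_0_lt_compat; nra|].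
  apply Rplus_le_le_0_compat; [easy|].
  apply Rmult_le_pos; lra.
Qed.

(** * Derivatives of A and E under the integral sign *)

Lemma is_derive_quarter_integral (f df : R -> R -> R) x : 0 < x ->
  (forall y t, 0 < y -> is_derive (fun z => f z t) y (df y t)) ->
  (forall y t, 0 < y -> continuity_2d_pt df y t) ->
  (forall y, 0 < y -> ex_RInt (fun t => f y t) 0 (PI / 2)) ->
  is_derive (fun y => RInt (fun t => f y t) 0 (PI / 2)) x
    (RInt (fun t => df x t) 0 (PI / 2)).
Proof.
  intros Hx Hd Hc Hi.
  (* The radius x / 2 keeps the parameter positive in a neighbourhood. *)
  assert (Hloc : forall y, Rabs (y - x) < x / 2 -> 0 < y)
    by (intros y Hy; apply Rabs_lt_between in Hy; lra).
  assert (Hpos : 0 < x / 2) by lra.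
  replace (RInt (fun t => df x t) 0 (PI / 2))
    with (RInt (fun t => Derive (fun u => f u t) x) 0 (PI / 2))
    by (apply RInt_ext; intros t _; now apply is_derive_unique, Hd).
  apply (is_derive_RInt_param f 0 (PI / 2) x).
  - exists (mkposreal _ Hpos); intros y Hy t _; eexists; apply Hd, Hloc; exact Hy.
  - intros t _; apply continuity_2d_pt_ext_loc with df; [|now apply Hc].
    exists (mkposreal _ Hpos); intros u v Hu _; symmetry.
    apply is_derive_unique, Hd, Hloc; exact Hu.
  - exists (mkposreal _ Hpos); intros y Hy; apply Hi, Hloc; exact Hy.
Qed.

Lemma continuity_2d_sin2_comp (g : R -> R) x t :
  ex_derive g (sin t ^ 2 + x) -> continuity_2d_pt (fun u v => g (sin v ^ 2 + u)) x t.
Proof.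
  intros Hg; apply (continuity_1d_2d_pt_comp g (fun u v => sin v ^ 2 + u)).
  - apply continuity_pt_filterlim; apply (ex_derive_continuous g); exact Hg.
  - apply continuity_2d_pt_plus; [|apply continuity_2d_pt_id1].
    apply (continuity_1d_2d_pt_comp (fun v => sin v ^ 2) (fun _ v => v));
      [|apply continuity_2d_pt_id2].
    apply continuity_pt_filterlim.
    apply (ex_derive_continuous (fun v => sin v ^ 2)); auto_derive; easy.
Qed.

(** Since u - s^2 / u = x / u, the integral of 1 / (2 u) is (E - A) / (2 x). *)
Lemma is_derive_ellE x : 0 < x -> is_derive ellE x ((ellE x - ellA x) / (2 * x)).
Proof.
  intros Hx.
  assert (H := is_derive_quarter_integral (fun y t => sqrt (sin t ^ 2 + y))
    (fun y t => / (2 * sqrt (sin t ^ 2 + y))) x Hx).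
  replace ((ellE x - ellA x) / (2 * x)) with
    (RInt (fun t => / (2 * sqrt (sin t ^ 2 + x))) 0 (PI / 2)).
  - apply H; intros y.
    + intros t Hy; pose proof (sin2_plus_pos y t Hy) as Hp; simpl in Hp.
      auto_derive; [easy|simpl; field]; apply Rgt_not_eq; now apply sqrt_lt_R0.
    + intros t Hy; pose proof (sin2_plus_pos y t Hy) as Hp.
      apply (continuity_2d_sin2_comp (fun z => / (2 * sqrt z))).
      pose proof (sqrt_lt_R0 _ Hp).
      auto_derive; repeat split; try easy; lra.
    + intros Hy; eexists; apply is_RInt_ellE; lra.
  - apply is_RInt_unique.
    pose proof (is_RInt_scal _ _ _ (/ (2 * x)) _ (is_RInt_minus _ _ _ _ _ _
      (is_RInt_ellE x (Rlt_le _ _ Hx)) (is_RInt_ellA x (Rlt_le _ _ Hx)))) as G.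
    replace ((ellE x - ellA x) / (2 * x)) with (scal (/ (2 * x)) (minus (ellE x) (ellA x)))
      by (unfold scal, minus, plus, opp; simpl; unfold mult; simpl; field; lra).
    eapply is_RInt_ext; [|exact G]; intros t _.
    unfold scal, minus, plus, opp; simpl; unfold mult; simpl.
    pose proof (sin2_plus_pos x t Hx) as Hp; simpl in Hp.
    pose proof (sqrt_lt_R0 _ Hp) as Hs; pose proof (sqrt_sqrt _ (Rlt_le _ _ Hp)) as Hq.
    set (u := sqrt (sin t * (sin t * 1) + x)) in *.
    replace (sin t * (sin t * 1)) with (u * u - x) by lra; field; lra.
Qed.

(** The integrand has derivative - (1 / u - x / u^3) / 2; the first term integrates to E - A up to a
    factor, the second by [is_RInt_sqrt_inv3]. *)
Lemma is_derive_ellA x : 0 < x ->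
  is_derive ellA x ((ellA x - ellE x / (1 + x)) / (2 * x)).
Proof.
  intros Hx.
  assert (H := is_derive_quarter_integral (fun y t => sin t ^ 2 / sqrt (sin t ^ 2 + y))
    (fun y t => (/ sqrt (sin t ^ 2 + y) - y * / sqrt (sin t ^ 2 + y) ^ 3) * (- / 2)) x Hx).
  replace ((ellA x - ellE x / (1 + x)) / (2 * x)) with
    (RInt (fun t => (/ sqrt (sin t ^ 2 + x) - x * / sqrt (sin t ^ 2 + x) ^ 3) * (- / 2))
       0 (PI / 2)).
  - apply H; intros y.
    + intros t Hy; pose proof (sin2_plus_pos y t Hy) as Hp; simpl in Hp.
      pose proof (sqrt_lt_R0 _ Hp) as Hs; pose proof (sqrt_sqrt _ (Rlt_le _ _ Hp)) as Hq.
      auto_derive; [repeat split; try easy; now apply Rgt_not_eq|].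
      simpl; set (u := sqrt (sin t * (sin t * 1) + y)) in *.
      replace (sin t * (sin t * 1)) with (u * u - y) by lra.
      field; lra.
    + intros t Hy; pose proof (sin2_plus_pos y t Hy) as Hp.
      pose proof (sqrt_lt_R0 _ Hp) as Hs.
      apply continuity_2d_pt_mult; [|apply continuity_2d_pt_const].
      apply continuity_2d_pt_minus.
      * apply (continuity_2d_sin2_comp (fun z => / sqrt z)).
        auto_derive; repeat split; try easy; lra.
      * apply continuity_2d_pt_mult; [apply continuity_2d_pt_id1|].
        apply (continuity_2d_sin2_comp (fun z => / sqrt z ^ 3)).
        assert (0 < sqrt (sin t ^ 2 + y) ^ 3) by (apply pow_lt; lra).
        auto_derive; repeat split; try easy; apply Rgt_not_eq; simpl in *; lra.
    + intros Hy; eexists; apply is_RInt_ellA; lra.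
  - apply is_RInt_unique.
    pose proof (is_RInt_scal _ _ _ (- / 2) _ (is_RInt_minus _ _ _ _ _ _
      (is_RInt_scal _ _ _ (/ x) _ (is_RInt_minus _ _ _ _ _ _
      (is_RInt_ellE x (Rlt_le _ _ Hx)) (is_RInt_ellA x (Rlt_le _ _ Hx))))
      (is_RInt_scal _ _ _ x _ (is_RInt_sqrt_inv3 x Hx)))) as G.
    match type of G with is_RInt _ _ _ ?v =>
      replace ((ellA x - ellE x / (1 + x)) / (2 * x)) with v
      by (unfold scal, minus, plus, opp; simpl; unfold mult; simpl; field; lra) end.
    eapply is_RInt_ext; [|exact G]; intros t _.
    unfold scal, minus, plus, opp; simpl; unfold mult; simpl.
    pose proof (sin2_plus_pos x t Hx) as Hp; simpl in Hp.
    pose proof (sqrt_lt_R0 _ Hp) as Hs; pose proof (sqrt_sqrt _ (Rlt_le _ _ Hp)) as Hq.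
    set (u := sqrt (sin t * (sin t * 1) + x)) in *.
    replace (sin t * (sin t * 1)) with (u * u - x) by lra; field; lra.
Qed.

(** * Monotonicity principles and affine bounds on A + E *)

Lemma nonneg_derive_le (f df : R -> R) a b : a <= b ->
  (forall x, a <= x <= b -> is_derive f x (df x)) ->
  (forall x, a <= x <= b -> 0 <= df x) -> f a <= f b.
Proof.
  intros Hab Hd Hp.
  destruct (MVT_gen f a b df) as [c [Hc E]].
  - intros x; rewrite Rmin_left, Rmax_right by lra; intros Hx; apply Hd; lra.
  - intros x; rewrite Rmin_left, Rmax_right by lra; intros Hx.
    apply continuity_pt_filterlim; apply (ex_derive_continuous f); eexists; apply Hd; lra.
  - rewrite Rmin_left, Rmax_right in Hc by lra.
    pose proof (Hp c Hc); nra.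
Qed.

(** For differential inequalities known only while f is positive. At the supremum c of the points
    where f >= f a, continuity gives f c >= f a > 0; were c < b, f would stay positive, hence
    nondecreasing, a little further. *)
Lemma nonneg_derive_while_pos (f df : R -> R) a b : a <= b ->
  (forall x, a <= x <= b -> is_derive f x (df x)) -> 0 < f a ->
  (forall x, a <= x <= b -> 0 < f x -> 0 <= df x) -> f a <= f b.
Proof.
  intros Hab Hd Ha Hp.
  assert (Hcont : forall x, a <= x <= b -> forall e, 0 < e ->
    exists d, 0 < d /\ forall y, Rabs (y - x) < d -> Rabs (f y - f x) < e).
  { intros x Hx e He.
    assert (C : continuity_pt f x)
      by (apply continuity_pt_filterlim; apply (ex_derive_continuous f); eexists; now apply Hd).
    destruct (C e He) as [d [Hd0 Hd1]]; exists d; split; [easy|].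
    intros y Hy; destruct (Req_dec x y) as [<-|Hn];
      [rewrite Rminus_diag, Rabs_R0; easy|].
    apply (Hd1 y); repeat split; easy. }
  destruct (completeness (fun t => a <= t <= b /\ f a <= f t)) as [c [Hub Hlub]].
  { exists b; intros t [Ht _]; lra. }
  { exists a; lra. }
  assert (Hac : a <= c) by (apply Hub; lra).
  assert (Hcb : c <= b) by (apply Hlub; intros t [Ht _]; lra).
  assert (Hfc : f a <= f c).
  { apply Rnot_lt_le; intros Hlt.
    destruct (Hcont c (conj Hac Hcb) (f a - f c)) as [d [Hd0 Hd1]]; [lra|].
    assert (c <= c - d); [|lra].
    apply Hlub; intros t [Ht1 Ht2]; apply Rnot_lt_le; intros Htd.
    assert (t <= c) by (now apply Hub).
    specialize (Hd1 t); rewrite Rabs_left1 in Hd1 by lra.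
    assert (Hd2 : - (t - c) < d) by lra.
    apply Hd1, Rabs_lt_between in Hd2; lra. }
  destruct Hcb as [Hcb | <-]; [exfalso|easy].
  destruct (Hcont c (conj Hac (Rlt_le _ _ Hcb)) (f c)) as [d [Hd0 Hd1]]; [lra|].
  set (c' := Rmin b (c + d / 2)).
  assert (Hc' : c < c' <= b) by (split; [apply Rmin_glb_lt; lra|apply Rmin_l]).
  assert (Hc'd : c' <= c + d / 2) by apply Rmin_r.
  assert (f c <= f c').
  { apply (nonneg_derive_le f df); [lra| |]; intros x Hx; [apply Hd; lra|].
    apply Hp; [lra|].
    assert (Hxd : Rabs (x - c) < d) by (rewrite Rabs_pos_eq; lra).
    apply Hd1, Rabs_lt_between in Hxd; lra. }
  assert (c' <= c); [|lra].
  apply Hub; lra.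
Qed.

(** Stands in for a limit at 0: A and E are differentiated at positive parameters only, so
    monotonicity arguments start from a small e, where elementary bounds leave an error of order
    sqrt e. *)
Lemma nonneg_of_ge_neg_sqrt x y : 0 < x ->
  (forall e, 0 < e <= x -> - 2 * sqrt e <= y) -> 0 <= y.
Proof.
  intros Hx H; apply Rnot_lt_le; intros Hy.
  set (e := Rmin x (y / 4 * (y / 4))).
  assert (He : 0 < e) by (apply Rmin_glb_lt; nra).
  assert (Hs : sqrt e <= - y / 4).
  { rewrite <- (sqrt_square (- y / 4)) by lra; apply sqrt_le_1_alt.
    apply Rle_trans with (1 := Rmin_r _ _); lra. }
  specialize (H e (conj He (Rmin_l _ _))); lra.
Qed.

Lemma is_derive_ellB x : 0 < x ->
  is_derive (fun y => ellA y + ellE y) x (ellE x / (2 * (1 + x))).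
Proof.
  intros Hx.
  replace (ellE x / (2 * (1 + x))) with
    ((ellA x - ellE x / (1 + x)) / (2 * x) + (ellE x - ellA x) / (2 * x)) by (field; lra).
  apply (is_derive_plus (V := R_NormedModule)); [now apply is_derive_ellA|now apply is_derive_ellE].
Qed.

Lemma ellB_ge_2 x : 0 <= x -> 2 <= ellA x + ellE x.
Proof.
  intros Hx; pose proof (ellA_ellE_ge_1 x Hx); pose proof (ellA_pos x Hx).
  pose proof (Rle_0_sqr (ellA x - ellE x)); unfold Rsqr in *; nra.
Qed.

Lemma ellB_le_affine x : 0 <= x -> ellA x + ellE x <= 2 + 0.556 * x.
Proof.
  intros [Hx | <-]; [|rewrite ellA_0, ellE_0; lra].
  pose proof PI_bounds.
  enough (0 <= 2 + 0.556 * x - (ellA x + ellE x)) by lra.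
  apply nonneg_of_ge_neg_sqrt with x; [easy|]; intros e He.
  apply Rle_trans with (2 + 0.556 * e - (ellA e + ellE e)).
  { pose proof (ellA_le_1 e); pose proof (ellE_le_near_0 e); pose proof (sqrt_pos e); nra. }
  apply (nonneg_derive_le (fun y => 2 + 0.556 * y - (ellA y + ellE y))
    (fun y => 0.556 - ellE y / (2 * (1 + y)))); [lra| |]; intros y Hy.
  - apply (is_derive_minus (V := R_NormedModule)); [|apply is_derive_ellB; lra].
    auto_derive; [easy|ring].
  - enough (ellE y <= 1.112 * (1 + y)).
    { enough (ellE y / (2 * (1 + y)) <= 0.556) by lra.
      apply Rle_div_l; lra. }
    pose proof (ellE_upper y) as Hu.
    (* From y + 1 / 2 <= (1 + y)^2 / 2, with 0.7075 just above 1 / sqrt 2. *)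
    assert (sqrt (y + 1 / 2) <= 0.7075 * (1 + y)); [|nra].
    rewrite <- (sqrt_square (0.7075 * (1 + y))) by lra; apply sqrt_le_1_alt; nra.
Qed.

(** The slope 0.38 exceeds [lam] and 1.62 exceeds 1 / (1 - lam), as the case rho = 1 of
    [seG_upper_end] requires. *)
Lemma ellB_ge_affine x : 0 <= x <= 1.62 -> 2 + 0.38 * x <= ellA x + ellE x.
Proof.
  intros [[Hx | <-] Hx2]; [|rewrite ellA_0, ellE_0; lra].
  pose proof PI_bounds.
  enough (0 <= ellA x + ellE x - (2 + 0.38 * x)) by lra.
  apply nonneg_of_ge_neg_sqrt with x; [easy|]; intros e He.
  apply Rle_trans with (ellA e + ellE e - (2 + 0.38 * e)).
  { pose proof (ellB_ge_2 e); pose proof (sqrt_pos e).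
    pose proof (sqrt_sqrt e (Rlt_le _ _ (proj1 He))).
    assert (sqrt e <= 2) by nra; nra. }
  apply (nonneg_derive_le (fun y => ellA y + ellE y - (2 + 0.38 * y))
    (fun y => ellE y / (2 * (1 + y)) - 0.38)); [lra| |]; intros y Hy.
  - apply (is_derive_minus (V := R_NormedModule)); [apply is_derive_ellB; lra|].
    auto_derive; [easy|ring].
  - enough (0.76 * (1 + y) <= ellE y).
    { enough (0.38 <= ellE y / (2 * (1 + y))) by lra.
      apply (Rle_div_r 0.38 (ellE y) (2 * (1 + y))); lra. }
    pose proof (ellE_chord y) as Hc.
    assert (1 + 0.38 * y <= sqrt (1 + y)).
    { rewrite <- (sqrt_square (1 + 0.38 * y)) by lra; apply sqrt_le_1_alt; nra. }
    assert (0.78 * y <= sqrt y); [|nra].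
    rewrite <- (sqrt_square (0.78 * y)) by lra; apply sqrt_le_1_alt; nra.
Qed.

(** * The inequality A E - lam x A^2 >= 1 *)

(* With c0 = 4 / delta_AMP one has lam = 1 - 1 / c0. *)
Definition lam : R := 2 - 16 / PI ^ 2.

Lemma lam_bounds : 0.377 < lam < 0.3794.
Proof.
  unfold lam; pose proof PI_bounds.
  assert (H1 : 9.8596 < PI ^ 2 < 9.8722) by (simpl; nra).
  assert (16 / PI ^ 2 < 1.623) by (apply Rlt_div_l; lra).
  assert (1.6206 < 16 / PI ^ 2) by (apply (Rlt_div_r 1.6206 16 (PI ^ 2)); lra).
  lra.
Qed.

(** Expresses that A E - lam x A^2 has the limit pi^2 / 8 - lam pi^2 / 16 = 1 at infinity. *)
Lemma lam_PI2 : (2 - lam) * (PI * PI) = 16.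
Proof. unfold lam; pose proof PI_bounds; field; lra. Qed.

Definition disc (x : R) : R := (1 - lam) * (1 - lam) * (x * x) + (1 - 2 * lam) * x.

(* Writing W = E / A, the derivative of A E - lam x A^2 is
   - A^2 (W - Wplus) (W - Wminus) / (2 x (1 + x)) with
   Wplus, Wminus = 1 + (1 + lam) x +- sqrt (disc x). *)
Definition Wplus (x : R) : R := 1 + (1 + lam) * x + sqrt (disc x).

Definition ratioW (x : R) : R := ellE x / ellA x.

(** The defect of [Wplus] in the Riccati equation of W: it equals (Wplus^2 / (1 + x) - 1) / (2 x) -
    Wplus'. *)
Definition Psi (x : R) : R :=
  ((1 - 2 * lam) + (1 - 2 * lam) * (1 + 2 * lam) * x
   + 2 * lam * ((1 - lam) * (1 - lam)) * (x * x)
   - 2 * lam * (1 + (1 - lam) * x) * sqrt (disc x)) / (2 * (1 + x) * sqrt (disc x)).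

Lemma disc_pos x : 0 < x -> 0 < disc x.
Proof. intros Hx; pose proof lam_bounds; unfold disc; nra. Qed.

Lemma sqrt_disc_bounds x : 0 < x -> (1 - lam) * x < sqrt (disc x) <= 1 + (1 - lam) * x.
Proof.
  intros Hx; pose proof lam_bounds; pose proof (disc_pos x Hx) as Hd.
  pose proof (sqrt_lt_R0 _ Hd); pose proof (sqrt_sqrt _ (Rlt_le _ _ Hd)) as Hq.
  unfold disc in Hq at 3.
  assert (0 < (1 - lam) * x) by nra.
  assert (0 < (1 - 2 * lam) * x) by nra.
  split; [apply Rsqr_incrst_0|apply Rsqr_incr_0]; unfold Rsqr; try lra; rewrite Hq; lra.
Qed.

Lemma is_derive_ratioW x : 0 < x ->
  is_derive ratioW x ((ratioW x * ratioW x / (1 + x) - 1) / (2 * x)).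
Proof.
  intros Hx; pose proof (ellA_pos x (Rlt_le _ _ Hx)) as HA.
  replace ((ratioW x * ratioW x / (1 + x) - 1) / (2 * x)) with
    (((ellE x - ellA x) / (2 * x) * ellA x
      - ellE x * ((ellA x - ellE x / (1 + x)) / (2 * x))) / ellA x ^ 2)
    by (unfold ratioW; field; lra).
  apply (is_derive_div ellE ellA); [now apply is_derive_ellE|now apply is_derive_ellA|lra].
Qed.

Lemma is_derive_Wplus x : 0 < x ->
  is_derive Wplus x (1 + lam + (2 * ((1 - lam) * (1 - lam)) * x + (1 - 2 * lam))
                               / (2 * sqrt (disc x))).
Proof.
  intros Hx; pose proof (disc_pos x Hx) as Hd; pose proof (sqrt_lt_R0 _ Hd).
  unfold Wplus, disc in *; auto_derive; [easy|]; field; lra.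
Qed.

Lemma is_derive_gap x : 0 < x ->
  is_derive (fun y => ratioW y - Wplus y) x
    ((ratioW x - Wplus x) * (ratioW x + Wplus x) / (2 * x * (1 + x)) + Psi x).
Proof.
  intros Hx; pose proof (disc_pos x Hx) as Hd; pose proof (sqrt_lt_R0 _ Hd) as Hs.
  pose proof (sqrt_sqrt _ (Rlt_le _ _ Hd)) as Hq; unfold disc in Hq at 3.
  match goal with |- is_derive _ _ ?v => replace v with
    ((ratioW x * ratioW x / (1 + x) - 1) / (2 * x)
     - (1 + lam + (2 * ((1 - lam) * (1 - lam)) * x + (1 - 2 * lam)) / (2 * sqrt (disc x)))) end.
  { apply (is_derive_minus (V := R_NormedModule)); [now apply is_derive_ratioW|now apply is_derive_Wplus]. }
  unfold Psi, Wplus; set (r := sqrt (disc x)) in *; set (w := ratioW x).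
  assert (Hq2 : r ^ 2 = (1 - lam) * (1 - lam) * (x * x) + (1 - 2 * lam) * x) by (simpl; lra).
  assert (Hq3 : r ^ 3 = r * ((1 - lam) * (1 - lam) * (x * x) + (1 - 2 * lam) * x))
    by (simpl; rewrite <- Hq; ring).
  field_simplify_eq; [|lra].
  rewrite ?Hq3, ?Hq2; ring.
Qed.

(** The numerator of [Psi] has the form q - h r with r = sqrt (disc x). Multiplying by q + h r > 0
    removes the root and leaves the cubic S, whose coefficients a0, a1, - a3 have signs +, +, -;
    hence S has a single positive root. *)
Lemma Psi_sign : exists x1, 0 < x1 /\ (forall x, 0 < x <= x1 -> 0 <= Psi x)
  /\ (forall x, x1 <= x -> Psi x <= 0).
Proof.
  pose proof lam_bounds as Hl.
  set (n := 1 - 2 * lam); set (m := 1 - lam).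
  set (a0 := n * n); set (a1 := 2 * n * n * (1 + 2 * lam) - 4 * (lam * lam) * n).
  set (a2 := n * n * ((1 + 2 * lam) * (1 + 2 * lam)) + 4 * lam * (m * m) * n
             - 4 * (lam * lam) * (2 * m * n + m * m)).
  set (a3 := 4 * lam * (m * m) * (3 * lam - 1)).
  set (S := fun x => a0 + a1 * x + a2 * (x * x) - a3 * (x * x * x)).
  assert (Hn : 0.24 < n < 0.25) by (unfold n; lra).
  assert (Hm : 0.62 < m < 0.63) by (unfold m; lra).
  assert (Ha0 : 0 < a0 < 1) by (unfold a0; nra).
  assert (Hl2 : 0.142 < lam * lam < 0.145) by nra.
  assert (Ha1 : 0 < a1 < 1).
  { unfold a1; replace (2 * n * n * (1 + 2 * lam) - 4 * (lam * lam) * n)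
      with (n * (2 - 12 * (lam * lam))) by (unfold n; ring); nra. }
  assert (Ha2 : a2 < 4).
  { unfold a2.
    assert (n * n * ((1 + 2 * lam) * (1 + 2 * lam)) < 2) by (apply Rlt_trans with (0.1 * 4); [apply Rmult_le_0_lt_compat; nra|lra]).
    assert (4 * lam * (m * m) * n < 2).
    { assert (m * m < 0.4) by nra; assert (0 < m * m) by nra.
      assert (0 < lam * (m * m) < 0.4) by nra; nra. }
    assert (0 <= 4 * (lam * lam) * (2 * m * n + m * m)) by (apply Rmult_le_pos; nra).
    lra. }
  assert (Ha3 : 0.05 < a3).
  { unfold a3; assert (0.38 < m * m) by nra.
    assert (0.143 < lam * (m * m)) by nra; nra. }
  assert (HS : exists x1, 0 < x1 /\ S x1 = 0).
  (* At 100 the cubic term is below - 5 * 10^4, while the others add up to less than 4 * 10^4 +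
     101. *)
  { destruct (IVT (fun x => - S x) 0 100) as [z [Hz1 Hz2]].
    - intros x; apply derivable_continuous; unfold S; reg.
    - lra.
    - unfold S; lra.
    - unfold S; lra.
    - exists z; split; [|lra].
      destruct Hz1 as [[Hz1|<-] _]; [easy|]; unfold S in Hz2; lra. }
  assert (HPsi : forall x, 0 < x -> exists k, 0 < k /\ k * Psi x = S x).
  { intros x Hx; pose proof (disc_pos x Hx) as Hd; pose proof (sqrt_lt_R0 _ Hd) as Hs.
    pose proof (sqrt_sqrt _ (Rlt_le _ _ Hd)) as Hq; unfold disc in Hq at 3.
    unfold Psi; set (r := sqrt (disc x)) in *.
    set (q := (1 - 2 * lam) + (1 - 2 * lam) * (1 + 2 * lam) * x
              + 2 * lam * ((1 - lam) * (1 - lam)) * (x * x)).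
    set (h := 2 * lam * (1 + (1 - lam) * x)).
    assert (0 < q).
    { unfold q; fold n m; assert (0 < n * (1 + 2 * lam) * x) by (repeat apply Rmult_lt_0_compat; lra).
      assert (0 < 2 * lam * (m * m) * (x * x)) by (repeat apply Rmult_lt_0_compat; lra). lra. }
    assert (0 < h * r).
    { apply Rmult_lt_0_compat; [|easy]; unfold h; apply Rmult_lt_0_compat; nra. }
    exists ((q + h * r) * (2 * (1 + x) * r)); split.
    - repeat apply Rmult_lt_0_compat; lra.
    - transitivity (q * q - h * h * (r * r)); [field; lra|].
      rewrite Hq; unfold q, h, S, a0, a1, a2, a3, n, m; ring. }
  destruct HS as [x1 [Hx1 HS1]]; exists x1.
  (* Eliminating a2, known only to be below 4, between S x and S x1 = 0 brings out x1 - x with a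
     positive cofactor. *)
  assert (Hcmp : forall x, 0 < x -> x1 * x1 * S x =
    (x1 - x) * (a0 * (x1 + x) + a1 * (x * x1) + a3 * (x * x * (x1 * x1)))).
  { intros x Hx; transitivity (x1 * x1 * S x - x * x * S x1); [rewrite HS1; ring|].
    unfold S; ring. }
  assert (Hfac : forall x, 0 < x -> 0 < a0 * (x1 + x) + a1 * (x * x1) + a3 * (x * x * (x1 * x1))).
  { intros x Hx; assert (0 < a0 * (x1 + x)) by (apply Rmult_lt_0_compat; lra).
    assert (0 < a1 * (x * x1)) by (repeat apply Rmult_lt_0_compat; lra).
    assert (0 < a3 * (x * x * (x1 * x1))) by (repeat apply Rmult_lt_0_compat; lra). lra. }
  assert (0 < x1 * x1) by nra.
  split; [easy|split]; intros x Hx; (assert (Hx0 : 0 < x) by lra);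
    destruct (HPsi x Hx0) as [k [Hk HkS]];
    specialize (Hcmp x Hx0); specialize (Hfac x Hx0).
  - assert (0 <= S x); [|nra].
    apply Rmult_le_reg_l with (x1 * x1); [easy|].
    rewrite Hcmp, Rmult_0_r; apply Rmult_le_pos; lra.
  - assert (S x <= 0); [|nra].
    apply Rmult_le_reg_l with (x1 * x1); [easy|].
    rewrite Hcmp, Rmult_0_r; nra.
Qed.

Lemma ratioW_ge x : 0 < x -> 1 + x <= ratioW x.
Proof.
  intros Hx; pose proof (ellA_pos x (Rlt_le _ _ Hx)).
  apply (Rle_div_r (1 + x) (ellE x) (ellA x)); [easy|apply ellE_ge_ellA; lra].
Qed.

Lemma Wplus_bounds x : 0 < x -> 1 + 2 * x <= Wplus x <= 2 + 2 * x.
Proof.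
  intros Hx; pose proof (sqrt_disc_bounds x Hx); unfold Wplus; lra.
Qed.

(* Past the sign change of Psi a negative gap W - Wplus would grow faster than x,
   whereas it is at least - (1 + x). *)
Lemma gap_nonneg_of_Psi_nonpos x1 : 0 < x1 -> (forall x, x1 <= x -> Psi x <= 0) ->
  forall x, x1 <= x -> Wplus x <= ratioW x.
Proof.
  intros Hx1 HPsi a Ha; apply Rnot_lt_le; intros Hlt.
  set (Z := fun y => ratioW y - Wplus y).
  set (dZ := fun x => (ratioW x - Wplus x) * (ratioW x + Wplus x) / (2 * x * (1 + x)) + Psi x).
  (* Uses W + Wplus >= 3 x, from W >= 1 + x and Wplus >= 1 + 2 x. *)
  assert (Hbelow : forall x, a <= x -> Z x < 0 -> dZ x <= Z x * (3 / (2 * (1 + x)))).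
  { intros x Hx Hz; unfold dZ; fold (Z x).
    assert (Hx0 : 0 < x) by lra.
    pose proof (HPsi x (Rle_trans _ _ _ Ha Hx)).
    pose proof (ratioW_ge x Hx0); pose proof (Wplus_bounds x Hx0).
    enough (3 / (2 * (1 + x)) <= (ratioW x + Wplus x) / (2 * x * (1 + x))).
    { unfold Rdiv at 1; rewrite Rmult_assoc.
      fold ((ratioW x + Wplus x) / (2 * x * (1 + x))); nra. }
    apply Rle_div_l; [lra|].
    replace ((ratioW x + Wplus x) / (2 * x * (1 + x)) * (2 * (1 + x)))
      with ((ratioW x + Wplus x) / x) by (field; lra).
    apply (Rle_div_r 3 _ x); lra. }
  assert (Hneg : forall x, a <= x -> Z x <= Z a).
  { intros x Hx.
    enough (- Z a <= - Z x) by lra.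
    apply (nonneg_derive_while_pos (fun y => - Z y) (fun y => - dZ y)); [easy| | |].
    - intros y Hy; apply (is_derive_opp (V := R_NormedModule) Z), is_derive_gap; lra.
    - unfold Z; lra.
    - intros y Hy Hz; pose proof (Hbelow y (proj1 Hy)) as Hb.
      assert (0 < 3 / (2 * (1 + y))) by (apply Rdiv_lt_0_compat; lra).
      assert (Hz2 : Z y < 0) by lra; specialize (Hb Hz2); nra. }
  assert (Hza : Z a < 0) by (unfold Z; lra).
  (* The previous inequality integrated: |Z| grows at least like (1 + x)^(3/2). *)
  assert (HT : forall b, a <= b -> Z a ^ 2 / (1 + a) ^ 3 <= Z b ^ 2 / (1 + b) ^ 3).
  { intros b Hb.
    apply (nonneg_derive_le (fun x => Z x ^ 2 / (1 + x) ^ 3)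
      (fun x => (2 * dZ x * Z x * (1 + x) ^ 3 - Z x ^ 2 * (3 * (1 + x) ^ 2)) / ((1 + x) ^ 3) ^ 2));
      [easy| |]; intros x Hx.
    - assert (0 < (1 + x) ^ 3) by (apply pow_lt; lra).
      apply (is_derive_div (fun y => Z y ^ 2) (fun y => (1 + y) ^ 3)); [| |lra].
      + replace (2 * dZ x * Z x) with (INR 2 * dZ x * Z x ^ (Nat.pred 2)) by (simpl; ring).
        apply (is_derive_pow Z 2 x (dZ x)), is_derive_gap; lra.
      + auto_derive; [easy|ring].
    - apply Rdiv_le_0_compat; [|apply pow_lt, pow_lt; lra].
      assert (Hzx : Z x < 0) by (pose proof (Hneg x (proj1 Hx)); lra).
      pose proof (Hbelow x (proj1 Hx) Hzx) as Hb2.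
      replace (2 * dZ x * Z x * (1 + x) ^ 3 - Z x ^ 2 * (3 * (1 + x) ^ 2))
        with (2 * (1 + x) ^ 3 * (Z x * (dZ x - Z x * (3 / (2 * (1 + x)))))) by (field; lra).
      apply Rmult_le_pos; [assert (0 < (1 + x) ^ 3) by (apply pow_lt; lra); lra|nra]. }
  set (k := Z a ^ 2 / (1 + a) ^ 3) in *.
  assert (Hk : 0 < k) by (apply Rdiv_lt_0_compat; [simpl; nra|apply pow_lt; lra]).
  (* This b makes 1 / (1 + b) < k, whereas |Z b| <= 1 + b forces k <= 1 / (1 + b). *)
  set (b := a + / k); assert (0 < / k) by (apply Rinv_0_lt_compat; lra).
  assert (Hb : a <= b) by (unfold b; lra).
  specialize (HT b Hb).
  assert (Z b ^ 2 / (1 + b) ^ 3 <= 1 / (1 + b)).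
  { assert (0 < (1 + b) ^ 3) by (apply pow_lt; lra).
    apply Rle_div_l; [easy|].
    replace (1 / (1 + b) * (1 + b) ^ 3) with ((1 + b) ^ 2) by (field; lra).
    pose proof (Hneg b Hb); pose proof (ratioW_ge b); pose proof (Wplus_bounds b).
    unfold Z in *; simpl; nra. }
  assert (1 / (1 + b) < k); [|lra].
  apply Rlt_div_l; [lra|].
  unfold b; replace (k * (1 + (a + / k))) with (k * (1 + a) + 1) by (field; lra); nra.
Qed.

(** F' is a nonpositive multiple of W - Wplus. If W > Wplus somewhere up to x, then W >= Wplus from
    x on, so F decreases from x towards its limit 1 at infinity; otherwise F increases on (0, x]
    from its limit 1 at 0. *)
Lemma fixed_curve_domination x : 0 <= x ->
  1 <= ellA x * ellE x - lam * x * (ellA x * ellA x).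
Proof.
  intros [Hx0 | <-]; [|rewrite ellA_0, ellE_0; lra].
  pose proof lam_bounds as Hl.
  set (F := fun x => ellA x * ellE x - lam * x * (ellA x * ellA x)).
  set (dF := fun x => - (ellA x * ellA x * (ratioW x - Wplus x)
     * (ratioW x - (1 + (1 + lam) * x) + sqrt (disc x)) / (2 * x * (1 + x)))).
  assert (HdF : forall y, 0 < y -> is_derive F y (dF y)).
  { intros y Hy; pose proof (is_derive_ellA y Hy) as HA; pose proof (is_derive_ellE y Hy) as HE.
    assert (ex_derive ellA y) by (eexists; exact HA).
    assert (ex_derive ellE y) by (eexists; exact HE).
    unfold F; auto_derive; [easy|].
    change (Derive (fun x => ellA x) y) with (Derive ellA y).
    change (Derive (fun x => ellE x) y) with (Derive ellE y).
    rewrite (is_derive_unique _ _ _ HA), (is_derive_unique _ _ _ HE).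
    pose proof (ellA_pos y (Rlt_le _ _ Hy)).
    unfold dF, Wplus, ratioW.
    pose proof (disc_pos y Hy) as Hd.
    pose proof (sqrt_sqrt _ (Rlt_le _ _ Hd)) as Hq; unfold disc in Hq at 3.
    set (r := sqrt (disc y)) in *.
    assert (Hq2 : r ^ 2 = (1 - lam) * (1 - lam) * (y * y) + (1 - 2 * lam) * y) by (simpl; lra).
    field_simplify_eq; [|lra]; rewrite ?Hq2; ring. }
  (* The factor W - Wminus is positive: W >= 1 + x, sqrt (disc x) > (1 - lam) x and 2 lam < 1. *)
  assert (HdFs : forall y, 0 < y -> exists k, 0 <= k /\ dF y = - (k * (ratioW y - Wplus y))).
  { intros y Hy; pose proof (sqrt_disc_bounds y Hy); pose proof (ratioW_ge y Hy).
    exists (ellA y * ellA y * (ratioW y - (1 + (1 + lam) * y) + sqrt (disc y)) / (2 * y * (1 + y))).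
    split; [|unfold dF; field; lra].
    apply Rdiv_le_0_compat; [apply Rmult_le_pos; nra|nra]. }
  assert (Hup : (forall y, x <= y -> Wplus y <= ratioW y) -> 1 <= F x).
  { intros HZ; apply Rnot_lt_le; intros HF.
    (* Chosen so that the lower bound 1 - 2 / (1 + b) for F b exceeds F x. *)
    set (b := x + 2 / (1 - F x)).
    assert (0 < 2 / (1 - F x)) by (apply Rdiv_lt_0_compat; lra).
    assert (Hb : x <= b) by (unfold b; lra).
    assert (F b <= F x).
    { enough (- F x <= - F b) by lra.
      apply (nonneg_derive_le (fun y => - F y) (fun y => - dF y)); [easy| |]; intros y Hy.
      - apply (is_derive_opp (V := R_NormedModule) F), HdF; lra.
      - destruct (HdFs y) as [k [Hk ->]]; [lra|]; pose proof (HZ y (proj1 Hy)); nra. }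
    (* A E >= (pi^2 / 8) b / (1 + b) and b A^2 <= pi^2 / 16; by [lam_PI2] the constants combine to
       1. *)
    assert (H1 : 1 - 2 / (1 + b) <= F b).
    { pose proof (ellA_lower b) as H1; pose proof (ellA_upper b) as H2.
      pose proof (ellE_ge_sqrt b) as H3; pose proof (ellA_pos b) as HA; pose proof PI_bounds.
      pose proof lam_PI2.
      assert (Hb0 : 0 <= b) by lra.
      specialize (H1 Hb0); specialize (H2 Hb0); specialize (H3 Hb0); specialize (HA Hb0).
      pose proof (sqrt_pos b) as Hs; pose proof (sqrt_sqrt b Hb0) as Hs2.
      assert (Ht : 0 < sqrt (1 + b)) by (apply sqrt_lt_R0; lra).
      assert (Ht2 : sqrt (1 + b) * sqrt (1 + b) = 1 + b) by (apply sqrt_sqrt; lra).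
      set (s := sqrt b) in *; set (t := sqrt (1 + b)) in *.
      assert (s <= t) by nra.
      assert (lam * b * (ellA b * ellA b) <= lam * (PI / 4 * (PI / 4))).
      { replace (lam * b * (ellA b * ellA b)) with (lam * ((s * ellA b) * (s * ellA b)))
          by (transitivity (lam * (s * s) * (ellA b * ellA b)); [ring|now rewrite Hs2]).
        apply Rmult_le_compat_l; [lra|]; assert (0 <= s * ellA b) by nra; nra. }
      assert (PI / 4 * (PI / 2) * (b / (1 + b)) <= ellA b * ellE b).
      { apply Rle_trans with ((PI / 4 / t) * (PI / 2 * s)).
        - replace (b / (1 + b)) with (s * s / (t * t)) by (rewrite Hs2, Ht2; easy).
          replace (PI / 4 * (PI / 2) * (s * s / (t * t)))
            with ((PI / 4 / t) * (PI / 2 * s) * (s / t)) by (field; lra).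
          rewrite <- (Rmult_1_r (PI / 4 / t * (PI / 2 * s))) at 2.
          apply Rmult_le_compat_l.
          + apply Rmult_le_pos; [apply Rdiv_le_0_compat; lra|nra].
          + apply Rle_div_l; lra.
        - apply Rmult_le_compat; [apply Rdiv_le_0_compat; lra|nra| |easy].
          apply Rle_div_l; lra. }
      unfold F.
      replace (b / (1 + b)) with (1 - 1 / (1 + b)) in * by (field; lra).
      assert (0 < 1 / (1 + b)) by (apply Rdiv_lt_0_compat; lra).
      replace (2 / (1 + b)) with (2 * (1 / (1 + b))) by (field; lra).
      assert (PI * PI < 16) by nra.
      assert (PI * PI * (1 / (1 + b)) <= 16 * (1 / (1 + b))) by (apply Rmult_le_compat_r; lra).
      lra. }
    assert (2 / (1 + b) < 1 - F x); [|lra].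
    apply Rlt_div_l; [lra|]; unfold b.
    replace ((1 - F x) * (1 + (x + 2 / (1 - F x)))) with ((1 - F x) * (1 + x) + 2) by (field; lra).
    nra. }
  destruct Psi_sign as [x1 [Hx1 [Hlow Hhigh]]].
  pose proof (gap_nonneg_of_Psi_nonpos x1 Hx1 Hhigh) as Hgap.
  destruct (Classical_Prop.classic (exists z, 0 < z <= x /\ Wplus z < ratioW z)) as [[z [Hz HW]]|Hno].
  - apply Hup; intros y Hy.
    destruct (Rle_lt_dec x1 y) as [H|H]; [now apply Hgap|].
    (* Before x1 both terms of the derivative of the gap are nonnegative while the gap is positive,
       so it cannot close again. *)
    enough (ratioW z - Wplus z <= ratioW y - Wplus y) by lra.
    apply (nonneg_derive_while_pos (fun y => ratioW y - Wplus y)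
      (fun x => (ratioW x - Wplus x) * (ratioW x + Wplus x) / (2 * x * (1 + x)) + Psi x));
      [lra| |lra|]; intros t Ht.
    + apply is_derive_gap; lra.
    + intros Hpos; assert (Ht0 : 0 < t) by lra.
      pose proof (ratioW_ge t Ht0); pose proof (Wplus_bounds t Ht0).
      apply Rplus_le_le_0_compat; [|apply Hlow; lra].
      apply Rdiv_le_0_compat; nra.
  - enough (0 <= F x - 1) by (unfold F in *; lra).
    apply nonneg_of_ge_neg_sqrt with (Rmin x 1); [apply Rmin_glb_lt; lra|]; intros e [He0 He].
    assert (He1 : e <= x) by (apply Rle_trans with (1 := He), Rmin_l).
    assert (He2 : e <= 1) by (apply Rle_trans with (1 := He), Rmin_r).
    apply Rle_trans with (F e - 1).
    + unfold F; pose proof (ellA_ellE_ge_1 e (Rlt_le _ _ He0)).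
      pose proof (ellA_le_1 e (Rlt_le _ _ He0)); pose proof (ellA_pos e (Rlt_le _ _ He0)).
      pose proof (sqrt_lt_R0 e He0); pose proof (sqrt_sqrt e (Rlt_le _ _ He0)).
      assert (e <= sqrt e) by nra.
      assert (lam * e * (ellA e * ellA e) <= sqrt e).
      { assert (0 < lam * e < e) by nra; assert (0 < ellA e * ellA e <= 1) by nra; nra. }
      lra.
    + enough (F e <= F x) by lra.
      apply (nonneg_derive_le F dF); [easy| |]; intros y Hy; [apply HdF; lra|].
      destruct (HdFs y) as [k [Hk ->]]; [lra|].
      assert (ratioW y <= Wplus y); [|nra].
      apply Rnot_lt_le; intros HW; apply Hno; exists y; lra.
Qed.

(** * Bounds on one step of the map *)

Definition seG (r x : R) : R := r * r * (1 + x) + 1 - r * (ellA x + ellE x).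

(** The minimum of the quadratic [seG r x] over all real r, attained at r = (A + E) / (2 (1 +
    x)). *)
Definition seG_min (x : R) : R := 1 - (ellA x + ellE x) * (ellA x + ellE x) / (4 * (1 + x)).

Lemma seG_min_le r x : 0 <= x -> seG_min x <= seG r x.
Proof.
  intros Hx; unfold seG_min, seG; set (B := ellA x + ellE x).
  enough (0 <= (1 + x) * ((r - B / (2 * (1 + x))) * (r - B / (2 * (1 + x))))) as H.
  { replace ((1 + x) * ((r - B / (2 * (1 + x))) * (r - B / (2 * (1 + x)))))
      with (r * r * (1 + x) - r * B + B * B / (4 * (1 + x))) in H by (field; lra).
    lra. }
  apply Rmult_le_pos; [lra|apply Rle_0_sqr].
Qed.

(** After multiplication by (1 + x)^2 the left side is at most (1 - p) x^2, where p = pi^2 / 16, by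
    [cos2_integral_bound] and (1 - lam) p = 1 - p. On the right, A + E is bounded by 2 + 0.556 x for
    x <= 2 and by (pi / 2) sqrt (x + 2) beyond. *)
Lemma seG_min_lower x : 0 < x ->
  (1 - lam) * x * ((ellE x / (1 + x) - ellA x) * (ellE x / (1 + x) - ellA x)) <= seG_min x.
Proof.
  intros Hx; pose proof PI_bounds as HPI; pose proof lam_bounds as Hl; pose proof lam_PI2 as HlP.
  pose proof (ellE_ge_ellA x) as H1; pose proof (cos2_integral_bound x) as H2.
  pose proof (ellB_le_affine x) as H3; pose proof (ellB_upper x) as H4.
  pose proof (ellB_ge_2 x) as H5.
  pose proof (sqrt_lt_R0 x Hx) as Hs; pose proof (sqrt_sqrt x (Rlt_le _ _ Hx)) as Hs2.
  set (B := ellA x + ellE x) in *; set (t := sqrt x) in *.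
  set (p := PI * PI / 16).
  assert (Hp : 0.616 < p < 0.6171) by (unfold p; nra).
  assert (Hlp : (1 - lam) * p = 1 - p) by (unfold p; lra).
  unfold seG_min; fold B.
  apply Rmult_le_reg_r with ((1 + x) * (1 + x)); [nra|].
  set (z := t * (ellE x - (1 + x) * ellA x)).
  assert (Hz : 0 <= z <= x * (PI / 4)) by (unfold z; split; [apply Rmult_le_pos; lra|apply H2; lra]).
  replace ((1 - lam) * x * ((ellE x / (1 + x) - ellA x) * (ellE x / (1 + x) - ellA x))
    * ((1 + x) * (1 + x))) with ((1 - lam) * (z * z))
    by (transitivity ((1 - lam) * (t * t * ((ellE x - (1 + x) * ellA x) * (ellE x - (1 + x) * ellA x))));
        [unfold z; ring|rewrite Hs2; field; lra]).
  replace ((1 - B * B / (4 * (1 + x))) * ((1 + x) * (1 + x)))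
    with ((1 + x) * (1 + x) - B * B * (1 + x) / 4) by (field; lra).
  assert (Hz2 : (1 - lam) * (z * z) <= (1 - p) * (x * x)).
  { rewrite <- Hlp; unfold p.
    replace ((1 - lam) * (PI * PI / 16) * (x * x))
      with ((1 - lam) * ((x * (PI / 4)) * (x * (PI / 4)))) by field.
    apply Rmult_le_compat_l; [lra|]; apply Rmult_le_compat; lra. }
  destruct (Rle_lt_dec x 2) as [Hx2|Hx2].
  - assert (B * B <= (2 + 0.556 * x) * (2 + 0.556 * x)) by (apply Rmult_le_compat; lra).
    assert (B * B * (1 + x) <= (2 + 0.556 * x) * (2 + 0.556 * x) * (1 + x))
      by (apply Rmult_le_compat_r; lra).
    assert ((1 - p) * (x * x) <= 0.384 * (x * x)) by (apply Rmult_le_compat_r; nra).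
    assert (x * x * x <= 2 * (x * x)) by nra.
    assert (x * x <= 2 * x) by nra.
    nra.
  - assert (B * B <= PI * PI / 4 * (x + 2)).
    { pose proof (sqrt_pos (x + 2)); pose proof (sqrt_sqrt (x + 2)).
      replace (PI * PI / 4 * (x + 2)) with ((PI / 2 * sqrt (x + 2)) * (PI / 2 * sqrt (x + 2)))
        by (transitivity (PI * PI / 4 * (sqrt (x + 2) * sqrt (x + 2))); [field|rewrite sqrt_sqrt; lra]).
      apply Rmult_le_compat; lra. }
    assert (B * B * (1 + x) <= PI * PI / 4 * (x + 2) * (1 + x)) by (apply Rmult_le_compat_r; lra).
    replace (PI * PI / 4) with (4 * p) in * by (unfold p; field).
    nra.
Qed.

Lemma seG_min_nonneg x : 0 <= x -> 0 <= seG_min x.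
Proof.
  intros [Hx | <-].
  - apply Rle_trans with (2 := seG_min_lower x Hx); pose proof lam_bounds.
    apply Rmult_le_pos; [nra|apply Rle_0_sqr].
  - unfold seG_min; rewrite ellA_0, ellE_0; lra.
Qed.

(** Serves [seG_upper_end] at rho = 1 / sqrt ((1 - lam) x), where both of its last inequalities
    reduce to this one. *)
Lemma ellB_large x : 1 <= (1 - lam) * x -> 1 + x <= sqrt ((1 - lam) * x) * (ellA x + ellE x).
Proof.
  intros Hx; pose proof lam_bounds; pose proof PI_bounds.
  assert (Hx1 : 1.6 < x) by nra.
  pose proof (ellB_chord x) as HB.
  assert (Hs : 0 < sqrt x) by (apply sqrt_lt_R0; lra).
  assert (Hs2 : sqrt x * sqrt x = x) by (apply sqrt_sqrt; lra).
  (* The square of 0.7877 is just below 1 - lam. *)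
  assert (Hh : 0.7877 * sqrt x <= sqrt ((1 - lam) * x)).
  { rewrite <- (sqrt_square (0.7877 * sqrt x)) by lra; apply sqrt_le_1_alt; nra. }
  assert (H3 : x + 1.05 <= sqrt x * sqrt (x + 3)).
  { rewrite <- sqrt_mult by lra.
    rewrite <- (sqrt_square (x + 1.05)) by lra; apply sqrt_le_1_alt; nra. }
  apply Rle_trans with (0.7877 * sqrt x * (0.785 * (sqrt x + sqrt (x + 3)))).
  - nra.
  - pose proof (sqrt_pos (x + 3)); apply Rmult_le_compat; nra.
Qed.

(* The pair (r, x) stands for sigma^2 = x r^2; the upper end of the allowed range
   of r is the minimum of 1 and 1 / sqrt ((1 - lam) x). *)
Lemma seG_upper_end x : 0 <= x -> exists rho, 0 < rho /\
  (forall r, 0 < r <= 1 -> (1 - lam) * (x * (r * r)) <= 1 -> r <= rho) /\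
  rho * (1 + x) <= ellA x + ellE x /\
  (1 + lam * x) * (rho * rho) - (ellA x + ellE x) * rho + 1 <= 0.
Proof.
  intros Hx; pose proof lam_bounds.
  destruct (Rle_lt_dec ((1 - lam) * x) 1) as [H1|H1].
  - exists 1; pose proof (ellB_ge_affine x) as HB.
    assert (Hx2 : 0 <= x <= 1.62) by (split; nra); specialize (HB Hx2).
    assert (0 <= (0.38 - lam) * x) by (apply Rmult_le_pos; lra).
    repeat split; intros; lra.
  - pose proof (ellB_large x (Rlt_le _ _ H1)) as HB.
    set (h := sqrt ((1 - lam) * x)) in *.
    assert (Hh : 0 < h) by (apply sqrt_lt_R0; lra).
    assert (Hh2 : h * h = (1 - lam) * x) by (apply sqrt_sqrt; lra).
    set (B := ellA x + ellE x) in *.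
    exists (/ h); split; [now apply Rinv_0_lt_compat|repeat split].
    + intros r Hr Hxr; apply Rmult_le_reg_r with h; [easy|].
      rewrite Rinv_l by lra.
      apply Rsqr_incr_0; unfold Rsqr; nra.
    + apply Rmult_le_reg_l with h; [easy|]; rewrite <- Rmult_assoc, Rinv_r by lra; lra.
    + apply Rmult_le_reg_l with (h * h); [nra|].
      replace (h * h * ((1 + lam * x) * (/ h * / h) - B * / h + 1))
        with (1 + lam * x - h * B + h * h) by (field; lra).
      rewrite Hh2; lra.
Qed.

Lemma seG_le_1 r x : 0 <= x -> 0 < r <= 1 -> (1 - lam) * (x * (r * r)) <= 1 -> seG r x <= 1.
Proof.
  intros Hx Hr Hxr.
  destruct (seG_upper_end x Hx) as [rho [Hrho [Hmax [HB _]]]].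
  specialize (Hmax r Hr Hxr); unfold seG.
  assert (r * (1 + x) <= ellA x + ellE x) by nra.
  nra.
Qed.

(** The claim says that (1 + lam x) r^2 - (A + E) r + 1 <= 0. This is convex in r and nonpositive at
    both ends: at r = A by [fixed_curve_domination], at rho by [seG_upper_end]. *)
Lemma seG_contracts r x : 0 <= x -> ellA x <= r <= 1 -> (1 - lam) * (x * (r * r)) <= 1 ->
  seG r x <= (1 - lam) * (x * (r * r)).
Proof.
  intros Hx Hr Hxr; pose proof lam_bounds; pose proof (ellA_pos x Hx) as HA.
  destruct (seG_upper_end x Hx) as [rho [Hrho [Hmax [_ Hq]]]].
  assert (Hr0 : 0 < r <= 1) by lra; specialize (Hmax r Hr0 Hxr).
  pose proof (fixed_curve_domination x Hx) as HD.
  enough ((1 + lam * x) * (r * r) - (ellA x + ellE x) * r + 1 <= 0) by (unfold seG; nra).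
  set (B := ellA x + ellE x) in *; set (k := 1 + lam * x) in *.
  assert (Hq0 : k * (ellA x * ellA x) - B * ellA x + 1 <= 0) by (unfold k, B; lra).
  assert (Hk : 0 < k) by (unfold k; nra).
  apply Rnot_lt_le; intros Hlt.
  assert (ellA x < r) by (destruct (proj1 Hr) as [|e]; [easy|rewrite <- e in Hlt; lra]).
  assert (r < rho) by (destruct Hmax as [|e]; [easy|rewrite e in Hlt; lra]).
  assert (0 < (r - ellA x) * (k * (r + ellA x) - B)) by nra.
  assert (0 < (rho - r) * (B - k * (rho + r))) by nra.
  assert (0 < k * (r + ellA x) - B) by nra.
  assert (0 < B - k * (rho + r)) by nra.
  nra.
Qed.

(** Contraction factor for b = sqrt (c (1 - lam)): b^2 is the factor when |alpha| does not increase,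
    the second term the largest excess when it grows. *)
Definition rate (b : R) : R := b * b + b * (1 - b) / (4 * (1 - lam)).

(** Since 4 (1 - lam) > 1, the excess is at most b (1 - b), whence [rate b] <= b. *)
Lemma rate_bounds b : 0 < b < 1 -> b * b <= rate b < 1 /\ 0 < rate b.
Proof.
  intros Hb; pose proof lam_bounds; unfold rate.
  assert (0 <= b * (1 - b)) by nra.
  assert (0 <= b * (1 - b) / (4 * (1 - lam)) <= b * (1 - b)).
  { split; [apply Rdiv_le_0_compat; lra|apply Rle_div_l; nra]. }
  nra.
Qed.

(* The regime in which |alpha| grows (r = A(y) < A(x)). Writing d = 1 - sqrt (x / y)
   and v = E(y) / ((1 + y) A(y)), the tangent bound on A + E gives
   seG r x <= y r^2 ((1 - lam) + d (v - 2 + d)), and the lower bound on sigma^2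
   left by the previous step forces d <= 1 - b (v - 1). *)
Lemma seG_growth_bound b c x y : 0 < b < 1 -> b * b = c * (1 - lam) ->
  0 <= x -> x <= y -> 0 < y ->
  c * seG_min y <= x * (ellA y * ellA y) ->
  c * seG (ellA y) x <= rate b * (y * (ellA y * ellA y)).
Proof.
  intros Hb Hbc Hx Hxy Hy Hm; pose proof lam_bounds as Hl.
  assert (Hc : 0 < c) by nra.
  pose proof (ellA_pos y (Rlt_le _ _ Hy)) as Hr.
  pose proof (seG_min_lower y Hy) as Hlow.
  pose proof (fixed_curve_domination y (Rlt_le _ _ Hy)) as HD.
  pose proof (ellB_tangent x y Hx Hy) as Ht.
  pose proof (ellE_ge_ellA y (Rlt_le _ _ Hy)) as HEA.
  pose proof (sqrt_pos x) as Hq; pose proof (sqrt_sqrt x Hx) as Hq2.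
  pose proof (sqrt_lt_R0 y Hy) as Hp; pose proof (sqrt_sqrt y (Rlt_le _ _ Hy)) as Hp2.
  assert (Hqp : sqrt x <= sqrt y) by (now apply sqrt_le_1_alt).
  set (r := ellA y) in *; set (q := sqrt x) in *; set (p := sqrt y) in *.
  set (v := ellE y / (1 + y) / r).
  assert (Hv : ellE y = v * ((1 + y) * r)) by (unfold v; field; lra).
  assert (Hv1 : 1 <= v).
  { unfold v; apply (Rle_div_r 1 _ r); [easy|]; apply (Rle_div_r (1 * r) _ (1 + y)); lra. }
  set (d := 1 - q / p).
  assert (Hqd : q = p * (1 - d)) by (unfold d; field; lra).
  assert (Hd : 0 <= d).
  { unfold d; enough (q / p <= 1) by lra; apply Rle_div_l; lra. }
  assert (HG : seG r x <= y * (r * r) * ((1 - lam) + d * (v - 2 + d))).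
  { assert (Ht2 : r + ellE y + p * (v * r) * (q - p) <= ellA x + ellE x).
    { replace (p * (v * r)) with (p * ellE y / (1 + y)) by (rewrite Hv; field; lra). easy. }
    unfold seG.
    apply Rle_trans with (r * r * (1 + x) + 1 - r * (r + ellE y + p * (v * r) * (q - p))).
    { apply Rplus_le_compat_l, Ropp_le_contravar, Rmult_le_compat_l; lra. }
    rewrite <- Hq2, Hqd.
    replace (r * r * (1 + p * (1 - d) * (p * (1 - d))) + 1
       - r * (r + ellE y + p * (v * r) * (p * (1 - d) - p)))
      with (r * r + 1 - r * (r + ellE y) + (p * p) * (r * r) * ((1 - d) * (1 - d) + v * d)) by ring.
    rewrite Hp2; lra. }
  (* [seG_min_lower] and the hypothesis on [seG_min y] give b (v - 1) sqrt y <= sqrt x. *)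
  assert (Hdv : d <= 1 - b * (v - 1)).
  { enough (b * (v - 1) * p <= q).
    { rewrite Hqd in *; assert (b * (v - 1) <= 1 - d) by nra; lra. }
    apply Rsqr_incr_0; unfold Rsqr; [|apply Rmult_le_pos; [apply Rmult_le_pos; lra|lra]|easy].
    rewrite Hq2.
    replace (b * (v - 1) * p * (b * (v - 1) * p)) with (b * b * ((v - 1) * (v - 1)) * (p * p)) by ring.
    rewrite Hp2, Hbc.
    apply Rmult_le_reg_r with (r * r); [nra|].
    apply Rle_trans with (2 := Hm).
    apply Rle_trans with (c * ((1 - lam) * y * ((ellE y / (1 + y) - r) * (ellE y / (1 + y) - r)))).
    - right; rewrite Hv; field; lra.
    - apply Rmult_le_compat_l; lra. }
  (* The bound on d gives d (v - 2 + d) <= (1 - b) d (v - 1), and z (1 - z) <= 1 / 4 is used at z =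
     b (v - 1). *)
  assert (Hprod : b * (d * (v - 2 + d)) <= (1 - b) / 4).
  { assert (0 <= (1 - b * (v - 1) - d) * d) by (apply Rmult_le_pos; lra).
    assert (d * (v - 2 + d) <= (1 - b) * (d * (v - 1))) by nra.
    assert (b * (d * (v - 1)) <= / 4).
    { assert (d * (b * (v - 1)) <= (1 - b * (v - 1)) * (b * (v - 1)))
        by (apply Rmult_le_compat_r; nra).
      pose proof (Rle_0_sqr (b * (v - 1) - / 2)); unfold Rsqr in *; lra. }
    assert (b * (d * (v - 2 + d)) <= b * ((1 - b) * (d * (v - 1))))
      by (apply Rmult_le_compat_l; lra).
    nra. }
  apply Rle_trans with (c * (y * (r * r) * ((1 - lam) + d * (v - 2 + d)))).
  { apply Rmult_le_compat_l; lra. }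
  unfold rate.
  replace (c * (y * (r * r) * (1 - lam + d * (v - 2 + d))))
    with ((c * (1 - lam) + c * (1 - lam) * (d * (v - 2 + d)) / (1 - lam)) * (y * (r * r)))
    by (field; lra).
  rewrite <- Hbc.
  apply Rmult_le_compat_r; [apply Rmult_le_pos; nra|].
  apply Rplus_le_compat_l.
  apply Rle_div_l; [lra|].
  replace (b * (1 - b) / (4 * (1 - lam)) * (1 - lam)) with (b * ((1 - b) / 4)) by (field; lra).
  rewrite Rmult_assoc; apply Rmult_le_compat_l; lra.
Qed.

(** * From the state evolution to a recursion in |alpha| and sigma^2 *)

(** Once one integrability proof exists, [epsilon] returns the integral for some such proof, and all
    of these equal [RInt]. *)
Lemma Rint_is_RInt f a b v : is_RInt f a b v -> Rint f a b = v.
Proof.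
  intros H; unfold Rint.
  destruct (epsilon_spec (inhabits 0)
    (fun v => exists pr : Riemann_integrable f a b, RiemannInt pr = v)) as [pr Hpr].
  - exists v.
    assert (Hex : ex_RInt f a b) by (now exists v).
    exists (ex_RInt_Reals_0 _ _ _ Hex).
    rewrite <- RInt_Reals; now apply is_RInt_unique.
  - rewrite <- Hpr, <- RInt_Reals; now apply is_RInt_unique.
Qed.

Lemma sqrt_homogeneous r s t : 0 < r -> 0 <= s -> 0 < t < PI / 2 ->
  sqrt (r ^ 2 * sin t ^ 2 + s) = r * sqrt (sin t ^ 2 + s / (r * r))
  /\ 0 < sqrt (sin t ^ 2 + s / (r * r)).
Proof.
  intros Hr Hs Ht; destruct (sin_quarter_bounds t Ht).
  assert (0 <= s / (r * r)) by (apply Rdiv_le_0_compat; nra).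
  assert (0 < sin t ^ 2) by (apply pow_lt; lra).
  split; [|apply sqrt_lt_R0; lra].
  replace (r ^ 2 * sin t ^ 2 + s) with ((r * r) * (sin t ^ 2 + s / (r * r))) by (field; lra).
  rewrite sqrt_mult, sqrt_square; nra.
Qed.

Lemma cabs_psi1 a s : 0 < cabs a -> 0 <= s ->
  cabs (psi1 a s) = ellA (s / (cabs a * cabs a)).
Proof.
  intros Ha Hs; set (x := s / (cabs a * cabs a)).
  assert (Hx : 0 <= x) by (apply Rdiv_le_0_compat; nra).
  pose proof (ellA_pos x Hx) as HA; pose proof PI_bounds.
  unfold psi1; rewrite (Rint_is_RInt _ _ _ (ellA x)).
  - unfold cphase; destruct (Req_EM_T (cabs a) 0) as [E|_]; [lra|].
    unfold cabs at 1; cbn [fst snd].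
    assert (Hc : cabs a * cabs a = fst a ^ 2 + snd a ^ 2)
      by (apply sqrt_sqrt; pose proof (pow2_ge_0 (fst a)); pose proof (pow2_ge_0 (snd a)); lra).
    replace ((fst a / cabs a * ellA x) ^ 2 + (snd a / cabs a * ellA x) ^ 2)
      with ((fst a ^ 2 + snd a ^ 2) / (cabs a * cabs a) * (ellA x * ellA x)) by (field; lra).
    rewrite <- Hc; unfold Rdiv; rewrite Rinv_r, Rmult_1_l by nra.
    apply sqrt_square; lra.
  - eapply is_RInt_ext; [|exact (is_RInt_ellA x Hx)].
    intros t; rewrite Rmin_left, Rmax_right by lra; intros Ht.
    destruct (sqrt_homogeneous (cabs a) s t Ha Hs Ht) as [E Hp]; fold x in E, Hp.
    match goal with |- ?p = ?q => change (@eq R p q) end.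
    rewrite E; field; lra.
Qed.

Lemma psi2_seG a s delta : 0 < cabs a -> 0 <= s ->
  psi2 a s delta 0 = 4 / delta * seG (cabs a) (s / (cabs a * cabs a)).
Proof.
  intros Ha Hs; set (x := s / (cabs a * cabs a)).
  assert (Hx : 0 <= x) by (apply Rdiv_le_0_compat; nra).
  pose proof PI_bounds.
  unfold psi2; rewrite (Rint_is_RInt _ _ _ (cabs a * (ellA x + ellE x))).
  - unfold seG.
    replace (cabs a * cabs a * (1 + x)) with (cabs a * cabs a + s) by (unfold x; field; lra).
    simpl; ring.
  - pose proof (is_RInt_scal _ _ _ (cabs a) _ (is_RInt_plus _ _ _ _ _ _
      (is_RInt_ellA x Hx) (is_RInt_ellE x Hx))) as G.
    eapply is_RInt_ext; [|exact G].
    intros t; rewrite Rmin_left, Rmax_right by lra; intros Ht.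
    destruct (sqrt_homogeneous (cabs a) s t Ha Hs Ht) as [E Hp]; fold x in E, Hp.
    assert (Hu : sqrt (sin t ^ 2 + x) * sqrt (sin t ^ 2 + x) = sin t ^ 2 + x)
      by (apply sqrt_sqrt; pose proof (pow2_ge_0 (sin t)); lra).
    rewrite E; unfold scal, plus; simpl; unfold mult; simpl.
    simpl in Hp, Hu; set (u := sqrt (sin t * (sin t * 1) + x)) in *.
    assert (Hsx : s = cabs a * cabs a * x) by (unfold x; field; lra).
    rewrite Hsx.
    replace (sin t * (sin t * 1)) with (u * u - x) by lra.
    field; lra.
Qed.

Lemma ratio_spec r s : 0 < r -> 0 <= s -> 0 <= s / (r * r) /\ s / (r * r) * (r * r) = s.
Proof. intros; split; [apply Rdiv_le_0_compat; nra|field; lra]. Qed.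

(** The condition (1 - lam) s <= 1 is what yields G <= 1, and c (1 - lam) < 1 then restores it. *)
Lemma state_step c r s : 0 < c -> c * (1 - lam) < 1 ->
  0 < r <= 1 -> 0 <= s -> (1 - lam) * s <= 1 ->
  0 < ellA (s / (r * r)) <= 1 /\ 0 <= c * seG r (s / (r * r))
  /\ (1 - lam) * (c * seG r (s / (r * r))) <= 1.
Proof.
  intros Hc Hcl Hr Hs Hls; pose proof lam_bounds.
  destruct (ratio_spec r s (proj1 Hr) Hs) as [Hx Hxs]; set (x := s / (r * r)) in *.
  pose proof (seG_min_nonneg x Hx); pose proof (seG_min_le r x Hx).
  assert (seG r x <= 1) by (apply seG_le_1; [easy|easy|rewrite Hxs; easy]).
  split; [split; [now apply ellA_pos|now apply ellA_le_1]|].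
  split; [apply Rmult_le_pos; lra|].
  replace ((1 - lam) * (c * seG r x)) with (c * (1 - lam) * seG r x) by ring.
  assert (0 < c * (1 - lam)) by nra; nra.
Qed.

(** * Trapping rectangles and convergence *)

Section Dynamics.

Context (c : R) (Hc : 0 < c) (Hcl : c * (1 - lam) < 1).
Context (r s : nat -> R).
Context (Hr : forall t, r (S t) = ellA (s t / (r t * r t))).
Context (Hs : forall t, s (S t) = c * seG (r t) (s t / (r t * r t))).
Context (Hr0 : 0 < r 0%nat <= 1) (Hs0 : 0 <= s 0%nat <= 1).

Lemma state_bounds t : 0 < r t <= 1 /\ 0 <= s t /\ (1 - lam) * s t <= 1.
Proof.
  pose proof lam_bounds.
  induction t as [|t [IH1 [IH2 IH3]]]; [repeat split; nra|].
  rewrite Hr, Hs; now apply state_step.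
Qed.

Lemma contracting_step t : ellA (s t / (r t * r t)) <= r t ->
  s (S t) <= c * (1 - lam) * s t.
Proof.
  intros HA; destruct (state_bounds t) as [B1 [B2 B3]].
  destruct (ratio_spec _ _ (proj1 B1) B2) as [Hx Hxs].
  rewrite Hs; set (x := s t / (r t * r t)) in *.
  pose proof (seG_contracts (r t) x Hx) as G; rewrite Hxs in G.
  rewrite Rmult_assoc; apply Rmult_le_compat_l; [lra|]; apply G; lra.
Qed.

(** sqrt x A(x) <= pi / 4 <= sqrt (s t) = sqrt x (r t), hence A(x) <= r t. *)
Lemma contracting_of_large t : PI * PI / 16 <= s t -> s (S t) <= c * (1 - lam) * s t.
Proof.
  intros Hp; apply contracting_step.
  destruct (state_bounds t) as [B1 [B2 B3]].
  destruct (ratio_spec _ _ (proj1 B1) B2) as [Hx Hxs].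
  set (x := s t / (r t * r t)) in *; pose proof PI_bounds.
  pose proof (ellA_upper x Hx) as HA; pose proof (ellA_pos x Hx).
  assert (0 < x) by (destruct Hx as [|e]; [easy|rewrite <- e in Hxs; nra]).
  pose proof (sqrt_lt_R0 x) as Hq; pose proof (sqrt_sqrt x Hx) as Hq2.
  apply Rmult_le_reg_l with (sqrt x); [now apply Hq|].
  apply Rle_trans with (1 := HA).
  apply Rsqr_incr_0; unfold Rsqr; [|lra|apply Rmult_le_pos; [apply sqrt_pos|lra]].
  replace (sqrt x * r t * (sqrt x * r t)) with (sqrt x * sqrt x * (r t * r t)) by ring.
  rewrite Hq2, Hxs; lra.
Qed.

Lemma exists_small : exists n, s (S n) < PI * PI / 16.
Proof.
  apply Classical_Prop.NNPP; intros Hno.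
  assert (Hlarge : forall n, PI * PI / 16 <= s (S n)).
  { intros n; apply Rnot_lt_le; intros Hlt; apply Hno; now exists n. }
  pose proof lam_bounds; pose proof PI_bounds.
  set (beta := c * (1 - lam)) in *.
  assert (Hb : 0 < beta) by (unfold beta; nra).
  assert (Hpow : forall n, s (S n) <= beta ^ n * s 1%nat).
  { induction n as [|n IH]; [simpl; lra|].
    apply Rle_trans with (1 := contracting_of_large _ (Hlarge n)); fold beta.
    simpl; rewrite Rmult_assoc; apply Rmult_le_compat_l; lra. }
  destruct (state_bounds 1) as [_ [_ B]].
  (* With beta^N < 1 / 4 this puts s below 1 / 2, although pi^2 / 16 > 0.6. *)
  assert (Hs1 : s 1%nat <= 2) by nra.
  destruct (pow_lt_1_zero beta (ltac:(rewrite Rabs_pos_eq; lra)) (1 / 4) (ltac:(lra))) as [N HN].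
  specialize (HN N (le_n N)); rewrite Rabs_pos_eq in HN by (apply pow_le; lra).
  pose proof (Hlarge 0%nat); pose proof (Hlarge N); pose proof (Hpow N).
  assert (0.6 < PI * PI / 16) by nra.
  nra.
Qed.

(* (r, s) lies in the rectangle whose corner is the point of parameter X on the
   curve r = A(x), s = x A(x)^2; the clause on seG_min records that it was
   reached from a state with s / r^2 = y. *)
Definition trapped (X : R) (t : nat) : Prop :=
  0 < X /\ exists y, 0 <= y <= X /\ r t = ellA y /\ c * seG_min y <= s t
                     /\ s t <= X * (ellA X * ellA X).

Lemma exists_trapped : exists n X, trapped X n.
Proof.
  destruct exists_small as [n Hn]; exists (S n).
  destruct (state_bounds n) as [B1 [B2 B3]].
  destruct (state_bounds (S n)) as [_ [C2 _]].
  destruct (ratio_spec _ _ (proj1 B1) B2) as [Hx _].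
  set (y := s n / (r n * r n)) in *; set (p := PI * PI / 16) in *.
  (* The quotient gives s (1 + X) <= X p, and p <= (1 + X) A(X)^2 turns this into s <= X A(X)^2; the
     other terms ensure y <= X and X > 0. *)
  set (X := y + s (S n) / (p - s (S n)) + 1).
  assert (0 <= s (S n) / (p - s (S n))) by (apply Rdiv_le_0_compat; lra).
  exists X; split; [unfold X; lra|]; exists y.
  split; [unfold X; lra|]; split; [apply Hr|]; split.
  - rewrite Hs; apply Rmult_le_compat_l; [lra|]; now apply seG_min_le.
  - assert (HX0 : 0 <= X) by (unfold X; lra).
    pose proof (ellA_lower X HX0) as HA; pose proof (ellA_pos X HX0).
    assert (Ht : 0 <= sqrt (1 + X)) by apply sqrt_pos.
    assert (Ht2 : sqrt (1 + X) * sqrt (1 + X) = 1 + X) by (apply sqrt_sqrt; lra).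
    pose proof PI_bounds.
    assert (p <= (1 + X) * (ellA X * ellA X)).
    { unfold p; rewrite <- Ht2 at 1.
      replace (sqrt (1 + X) * sqrt (1 + X) * (ellA X * ellA X))
        with ((sqrt (1 + X) * ellA X) * (sqrt (1 + X) * ellA X)) by ring.
      replace (PI * PI / 16) with (PI / 4 * (PI / 4)) by field.
      apply Rmult_le_compat; lra. }
    assert (Hsx : s (S n) <= X * (p - s (S n))).
    { apply Rle_trans with (s (S n) / (p - s (S n)) * (p - s (S n))); [right; field; lra|].
      apply Rmult_le_compat_r; [lra|unfold X; lra]. }
    apply Rmult_le_reg_r with (1 + X); [lra|].
    apply Rle_trans with (X * p); [lra|].
    replace (X * (ellA X * ellA X) * (1 + X)) with (X * ((1 + X) * (ellA X * ellA X))) by ring.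
    apply Rmult_le_compat_l; lra.
Qed.

Lemma curve_incr x y : 0 <= x -> x <= y -> x * (ellA x * ellA x) <= y * (ellA y * ellA y).
Proof.
  intros Hx Hxy; pose proof (sqrt_ellA_incr x y Hx Hxy) as H.
  assert (Hy : 0 <= y) by lra.
  replace (x * (ellA x * ellA x)) with ((sqrt x * ellA x) * (sqrt x * ellA x))
    by (transitivity (sqrt x * sqrt x * (ellA x * ellA x)); [ring|now rewrite sqrt_sqrt]).
  replace (y * (ellA y * ellA y)) with ((sqrt y * ellA y) * (sqrt y * ellA y))
    by (transitivity (sqrt y * sqrt y * (ellA y * ellA y)); [ring|now rewrite sqrt_sqrt]).
  pose proof (ellA_pos x Hx); pose proof (sqrt_pos x).
  assert (0 <= sqrt x * ellA x) by nra.
  apply Rmult_le_compat; lra.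
Qed.

(** If |alpha| does not increase, [contracting_step] applies. Otherwise A(x) > A(y) forces x < y,
    [seG_growth_bound] bounds s by its value on the curve at y, and the curve is increasing in its
    parameter. *)
Lemma trapped_step X t : trapped X t ->
  0 <= s t / (r t * r t) <= X /\ c * seG_min (s t / (r t * r t)) <= s (S t)
  /\ s (S t) <= rate (sqrt (c * (1 - lam))) * (X * (ellA X * ellA X)).
Proof.
  intros [HX [y [Hy [Hry [Hmin Hsx]]]]]; pose proof lam_bounds.
  destruct (state_bounds t) as [B1 [B2 B3]].
  destruct (ratio_spec _ _ (proj1 B1) B2) as [Hx Hxs].
  assert (HAX : 0 < ellA X) by (apply ellA_pos; lra).
  assert (HAy : ellA X <= r t) by (rewrite Hry; apply ellA_decr; lra).
  assert (Hbeta : 0 < c * (1 - lam)) by nra.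
  set (b := sqrt (c * (1 - lam))).
  assert (Hb2 : b * b = c * (1 - lam)) by (apply sqrt_sqrt; lra).
  assert (Hb : 0 < b < 1) by (assert (0 < b) by (now apply sqrt_lt_R0); nra).
  destruct (rate_bounds b Hb) as [Hrate Hrate0].
  split; [|split].
  - split; [easy|].
    apply Rle_div_l; [nra|].
    apply Rle_trans with (1 := Hsx); apply Rmult_le_compat_l; [lra|nra].
  - rewrite Hs; apply Rmult_le_compat_l; [lra|]; now apply seG_min_le.
  - destruct (Rle_lt_dec (ellA (s t / (r t * r t))) (r t)) as [Hle|Hlt].
    + apply Rle_trans with (1 := contracting_step t Hle); rewrite <- Hb2.
      apply Rmult_le_compat; nra.
    + assert (Hxy : s t / (r t * r t) < y).
      { apply Rnot_le_lt; intros Hyx.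
        pose proof (ellA_decr y _ (proj1 Hy) Hyx); lra. }
      apply Rle_trans with (rate b * (y * (ellA y * ellA y))).
      * pose proof (seG_growth_bound b c (s t / (r t * r t)) y Hb Hb2 Hx) as G.
        rewrite <- Hry, Hxs in G; rewrite Hs, <- Hry; apply G; lra.
      * apply Rmult_le_compat_l; [lra|]; apply curve_incr; lra.
Qed.

Lemma rate_sqrt_bounds : 0 < rate (sqrt (c * (1 - lam))) < 1.
Proof.
  pose proof lam_bounds.
  assert (Hb2 : sqrt (c * (1 - lam)) * sqrt (c * (1 - lam)) = c * (1 - lam))
    by (apply sqrt_sqrt; nra).
  assert (Hb : 0 < sqrt (c * (1 - lam))) by (apply sqrt_lt_R0; nra).
  destruct (rate_bounds (sqrt (c * (1 - lam)))); [nra|lra].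
Qed.

Lemma trapped_next X t : trapped X t -> trapped X (S t).
Proof.
  intros HT; destruct (trapped_step X t HT) as [Hx [Hmin Hup]].
  destruct HT as [HX _]; split; [easy|].
  exists (s t / (r t * r t)); repeat split; try easy.
  apply Rle_trans with (1 := Hup).
  pose proof rate_sqrt_bounds.
  assert (0 < ellA X) by (apply ellA_pos; lra).
  rewrite <- (Rmult_1_l (X * (ellA X * ellA X))) at 2.
  apply Rmult_le_compat_r; [apply Rmult_le_pos; nra|lra].
Qed.

(** Two steps are taken: the first lowers sigma^2, so that the ratio sigma^2 / |alpha|^2 drops below
    k X and enters as the new y at the second. The corner then moves to k X because A(X) <= A(k
    X). *)
Lemma trapped_shrink X t : trapped X t ->
  trapped (rate (sqrt (c * (1 - lam))) * X) (S (S t)).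
Proof.
  intros HT; destruct (trapped_step X t HT) as [Hx [Hmin Hup]].
  pose proof (trapped_next X t HT) as HT1.
  destruct (trapped_step X (S t) HT1) as [Hx1 [Hmin1 Hup1]].
  destruct HT as [HX _]; pose proof rate_sqrt_bounds as Hk.
  set (k := rate (sqrt (c * (1 - lam)))) in *.
  assert (HkX : 0 < k * X <= X) by nra.
  assert (HAX : 0 < ellA X) by (apply ellA_pos; lra).
  split; [lra|].
  exists (s (S t) / (r (S t) * r (S t))); repeat split; try easy.
  - destruct (state_bounds (S t)) as [B1 _].
    assert (ellA X <= r (S t)) by (rewrite Hr; now apply ellA_decr).
    apply Rle_div_l; [nra|].
    apply Rle_trans with (1 := Hup); rewrite <- Rmult_assoc.
    apply Rmult_le_compat_l; nra.
  - apply Rle_trans with (1 := Hup1); rewrite <- Rmult_assoc.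
    apply Rmult_le_compat_l; [lra|].
    assert (ellA X <= ellA (k * X)) by (apply ellA_decr; lra).
    nra.
Qed.

Lemma eventually_trapped e : 0 < e -> exists X N, X < e /\ forall t, (N <= t)%nat -> trapped X t.
Proof.
  intros He; destruct exists_trapped as [n [X0 HT]].
  set (k := rate (sqrt (c * (1 - lam)))).
  assert (Hk : 0 < k < 1) by apply rate_sqrt_bounds.
  assert (Hiter : forall m, trapped (k ^ m * X0) (2 * m + n)).
  { induction m as [|m IH]; [simpl; rewrite Rmult_1_l; easy|].
    replace (2 * S m + n)%nat with (S (S (2 * m + n))) by lia.
    simpl; rewrite Rmult_assoc; now apply trapped_shrink. }
  assert (HX0 : 0 < X0) by apply HT.
  destruct (pow_lt_1_zero k (ltac:(rewrite Rabs_pos_eq; lra)) (e / X0)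
    (ltac:(now apply Rdiv_lt_0_compat))) as [M HM].
  specialize (HM M (le_n M)); rewrite Rabs_pos_eq in HM by (apply pow_le; lra).
  exists (k ^ M * X0), (2 * M + n)%nat; split.
  - apply (Rlt_div_r (k ^ M) e X0); lra.
  - intros t Ht; induction Ht as [|t Ht IH]; [apply Hiter|now apply trapped_next].
Qed.

Lemma dynamics_converge : Un_cv r 1 /\ Un_cv s 0.
Proof.
  pose proof PI_bounds.
  split; intros e He.
  (* With sqrt y < e / 2, the error 1 - A(y) <= (pi / 2) sqrt y is below e. *)
  - destruct (eventually_trapped (e / 2 * (e / 2))) as [X [N [HX HN]]]; [nra|].
    exists N; intros t Ht.
    destruct (HN t Ht) as [HX0 [y [Hy [-> _]]]].
    pose proof (ellA_le_1 y (proj1 Hy)); pose proof (ellA_near_0 y (proj1 Hy)).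
    assert (sqrt y < e / 2).
    { rewrite <- (sqrt_square (e / 2)) by lra; apply sqrt_lt_1_alt; lra. }
    pose proof (sqrt_pos y).
    unfold Rdist; rewrite Rabs_left1 by lra; nra.
  - destruct (eventually_trapped e He) as [X [N [HX HN]]].
    exists N; intros t Ht.
    destruct (HN t Ht) as [HX0 [y [Hy [_ [_ Hup]]]]].
    destruct (state_bounds t) as [_ [Hst _]].
    pose proof (ellA_le_1 X (Rlt_le _ _ HX0)); pose proof (ellA_pos X (Rlt_le _ _ HX0)).
    assert (ellA X * ellA X <= 1) by nra.
    unfold Rdist; rewrite Rminus_0_r, Rabs_pos_eq by easy; nra.
Qed.

End Dynamics.

(** * Convergence of the state evolution above the threshold *)

Theorem mainTheorem1 :
  forall delta : R, delta > 64 / PI ^ 2 - 4 ->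
  forall (a0 : R * R) (s0 : R),
    0 < cabs a0 <= 1 -> 0 <= s0 <= 1 ->
    Un_cv (fun t => cabs (fst (se delta 0 a0 s0 t))) 1 /\
    Un_cv (fun t => snd (se delta 0 a0 s0 t)) 0.
Proof.
  intros delta Hdelta a0 s0 Ha Hs; pose proof lam_bounds as Hl.
  (* The threshold 64 / PI^2 - 4 equals 4 (1 - lam). *)
  assert (Hdl : 4 * (1 - lam) < delta) by (unfold lam; lra).
  assert (Hc : 0 < 4 / delta) by (apply Rdiv_lt_0_compat; lra).
  assert (Hcl : 4 / delta * (1 - lam) < 1).
  { replace (4 / delta * (1 - lam)) with (4 * (1 - lam) / delta) by (field; lra).
    apply Rlt_div_l; lra. }
  (* Rewriting [psi1] and [psi2] through A and G needs |alpha| > 0 and sigma^2 >= 0 at every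
     step. *)
  assert (Hpos : forall t, 0 < cabs (fst (se delta 0 a0 s0 t)) <= 1
     /\ 0 <= snd (se delta 0 a0 s0 t)
     /\ (1 - lam) * snd (se delta 0 a0 s0 t) <= 1).
  { induction t as [|t [IH1 [IH2 IH3]]]; [simpl; nra|].
    cbn [se fst snd].
    set (a := fst (se delta 0 a0 s0 t)) in *; set (s := snd (se delta 0 a0 s0 t)) in *.
    rewrite cabs_psi1, psi2_seG by easy.
    now apply state_step. }
  apply (dynamics_converge (4 / delta) Hc Hcl); try easy; intros t;
    destruct (Hpos t) as [H1 [H2 _]]; cbn [se fst snd];
    [apply cabs_psi1|apply psi2_seG]; easy.
Qed.
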